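(* There is a polynomial-time algorithm for Robust Interval Scheduling.
   Context: Robust Interval Scheduling: the input is a finite set $I=\{i_1,\dots,i_n\}$ of jobs, job $i_j$ being a half-open interval $[a_j,b_j)$ with $a_j,b_j\in\mathbb{N}$, $a_j\le b_j$, together with weights $w:I\to\mathbb{R}_{\ge0}$. Let $\mathcal{F}$ be the family of subsets of $I$ consisting of pairwise disjoint intervals. The task is to solve $$\max_{S\in\mathcal{F}}\ \min_{f\in I\cup\{\emptyset\}}\ \max_{\substack{e\in (I\setminus(S\cup\{f\}))\cup\{\emptyset\}\\ (S\setminus\{f\})\cup\{e\}\in\mathcal{F}}} w\big((S\setminus\{f\})\cup\{e\}\big),$$ where $w$ of a set is the sum of weights, $f=\emptyset$ means no job is deleted and $e=\emptyset$ means no job is added (i.e., output an optimal first-stage solution $S$). *)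

(* Defs.v *)
From Stdlib Require Import Reals Arith List Bool.
Open Scope R_scope.

(* Instances: n jobs, job j (j < n) is the half-open interval [a j, b j)
   with weight w j.  Subsets of I are boolean predicates on indices
   (only indices j < n matter).                                        *)

Definition disjb (a b : nat -> nat) (i j : nat) : bool :=
  (b i <=? a j)%nat || (b j <=? a i)%nat || (b i <=? a i)%nat || (b j <=? a j)%nat.

Definition feasibleb (n : nat) (a b : nat -> nat) (S : nat -> bool) : bool :=
  forallb (fun i => forallb (fun j =>
     implb (S i && S j && negb (i =? j)%nat) (disjb a b i j)) (seq 0 n)) (seq 0 n).

Definition feasible n a b S : Prop := feasibleb n a b S = true.

Definition weight (n : nat) (w : nat -> R) (S : nat -> bool) : R :=
  fold_right Rplus 0 (map (fun j => if S j then w j else 0) (seq 0 n)).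

(* (S \ {f}) u {e}, with None standing for the empty choice *)
Definition modify (S : nat -> bool) (f e : option nat) : nat -> bool :=
  fun j => (S j && negb (match f with Some i => (i =? j)%nat | None => false end))
           || (match e with Some i => (i =? j)%nat | None => false end).

Definition adm_e (n : nat) (a b : nat -> nat) (S : nat -> bool) (f : option nat)
  : list (option nat) :=
  None :: filter (fun e => match e with
                           | Some j => negb (S j)
                                       && negb (match f with Some i => (i =? j)%nat | None => false end)
                                       && feasibleb n a b (modify S f e)
                           | None => false end)
                 (map Some (seq 0 n)).

Definition max_list (l : list R) (d : R) : R := fold_right Rmax d l.
Definition min_list (l : list R) (d : R) : R := fold_right Rmin d l.

Definition recovery (n : nat) (a b : nat -> nat) (w : nat -> R) (S : nat -> bool)
  (f : option nat) : R :=
  max_list (map (fun e => weight n w (modify S f e)) (adm_e n a b S f))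
           (weight n w (modify S f None)).

Definition robust_value (n : nat) (a b : nat -> nat) (w : nat -> R) (S : nat -> bool) : R :=
  min_list (map (recovery n a b w S) (None :: map Some (seq 0 n)))
           (recovery n a b w S None).

Definition optimal_robust (n : nat) (a b : nat -> nat) (w : nat -> R) (S : nat -> bool) : Prop :=
  feasible n a b S /\
  forall S', feasible n a b S' -> robust_value n a b w S' <= robust_value n a b w S.

(* Computation model: a unit-cost real-RAM with a nat memory M (indirect
   addressing, +, truncated -, zero test) and a real memory Rm
   (addressed through nat registers) supporting 0, +, - and <=.        *)

Inductive instr : Type :=
| NConst (d c : nat)          (* M[d] := c *)
| NAdd (d x y : nat)          (* M[d] := M[x] + M[y] *)
| NSub (d x y : nat)          (* M[d] := M[x] - M[y] (truncated) *)
| NLoad (d x : nat)           (* M[d] := M[M[x]] *)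
| NStore (x y : nat)          (* M[M[x]] := M[y] *)
| NJz (x l : nat)             (* if M[x] = 0 then goto l *)
| RZero (d : nat)             (* Rm[M[d]] := 0 *)
| RAdd (d x y : nat)          (* Rm[M[d]] := Rm[M[x]] + Rm[M[y]] *)
| RSub (d x y : nat)          (* Rm[M[d]] := Rm[M[x]] - Rm[M[y]] *)
| RLe (d x y : nat)           (* M[d] := if Rm[M[x]] <= Rm[M[y]] then 1 else 0 *)
| Halt.

Definition program := list instr.

Record state : Type := mkState { pc : nat; mem : nat -> nat; rmem : nat -> R }.

Definition upd {A : Type} (m : nat -> A) (i : nat) (v : A) : nat -> A :=
  fun k => if (k =? i)%nat then v else m k.

Definition halted (P : program) (s : state) : Prop :=
  match nth_error P (pc s) with None | Some Halt => True | _ => False end.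

Definition step (P : program) (s : state) : state :=
  let M := mem s in let Rm := rmem s in let p := pc s in
  match nth_error P p with
  | None | Some Halt => s
  | Some (NConst d c) => mkState (S p) (upd M d c) Rm
  | Some (NAdd d x y) => mkState (S p) (upd M d (M x + M y)%nat) Rm
  | Some (NSub d x y) => mkState (S p) (upd M d (M x - M y)%nat) Rm
  | Some (NLoad d x) => mkState (S p) (upd M d (M (M x))) Rm
  | Some (NStore x y) => mkState (S p) (upd M (M x) (M y)) Rm
  | Some (NJz x l) => mkState (if (M x =? 0)%nat then l else S p) M Rm
  | Some (RZero d) => mkState (S p) M (upd Rm (M d) 0)
  | Some (RAdd d x y) => mkState (S p) M (upd Rm (M d) (Rm (M x) + Rm (M y)))
  | Some (RSub d x y) => mkState (S p) M (upd Rm (M d) (Rm (M x) - Rm (M y)))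
  | Some (RLe d x y) =>
      mkState (S p) (upd M d (if Rle_dec (Rm (M x)) (Rm (M y)) then 1%nat else 0%nat)) Rm
  end.

Fixpoint exec (P : program) (t : nat) (s : state) : state :=
  match t with O => s | S t' => exec P t' (step P s) end.

(* Input encoding: M[0] = n, M[2j+1] = a j, M[2j+2] = b j (j < n),
   Rm[j] = w j (j < n), everything else 0; execution starts at pc 0. *)
Definition init_state (n : nat) (a b : nat -> nat) (w : nat -> R) : state :=
  mkState 0
    (fun i => if (i =? 0)%nat then n
              else if (i <=? 2 * n)%nat then
                     (if Nat.odd i then a ((i - 1) / 2)%nat else b ((i - 2) / 2)%nat)
              else 0%nat)
    (fun j => if (j <? n)%nat then w j else 0).

Definition output (n : nat) (s : state) : nat -> bool :=
  fun j => (j <? n)%nat && negb (mem s (2 * n + 1 + j) =? 0)%nat.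

(* Main.v *)
Require Import Defs.
From Stdlib Require Import Reals Lra Lia Arith List Bool Permutation Classical.
Import ListNotations.
Open Scope R_scope.

(** A solution [S] of robust value [w S - l] is certified by its loss [l], which is the difference
    of two weights, by the two heaviest jobs [e1], [e2] that can be added to [S], and by a
    replacement [e] for every [f] in [S]: either [e = e1], or [e] overlaps [f] and no other job
    of [S].  In the second case [e] fits between the neighbours of [f] in [S], so for a fixed guess
    of [l], [e1], [e2] the certified solutions are the paths of an acyclic graph on the pairs
    [(f, e)], and a heaviest one is found by Bellman-Ford relaxation.  Trying all guesses yields
    the optimal value over the solutions contained in a given set [X] of jobs.  Removing from [X]
    one job after the other, whenever this does not lower that value, leaves exactly an optimal
    solution.

    The algorithm is written in a language whose loops all run over [0..n], so that polynomial
    time is automatic, and which is compiled to the real-RAM. *)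

(** * Recovery values *)

(** Fixing the loss [l] turns the minimum over all failures into one local condition per job,
    [w f <= l + w e]. Some failure [f0] and reply [e0] attain the robust value, so the differences
    [w f0 - w e0] are enough guesses for [l]. A best reply to the failure of [f] that is disjoint
    from [f] could be added to [S] without deleting anything, so [e1] serves as well; hence only
    replacements overlapping [f] are recorded, and these are confined to the gap around [f]. Two
    addable jobs are kept because a failing job outside [S] cannot be added either: when [e1] itself
    fails, [e2] is the reply. A wrong guess still yields a valid lower bound, since the local
    conditions alone exhibit a reply to every failure; guesses can therefore be tried blindly. The
    empty choice is a dummy job [n] with an empty interval and weight 0, which spares a separate
    case for it in chains, tests and code. Elimination asks only for optimal values, so the dynamic
    program stores no predecessors and no path has to be decoded. *)

Lemma max_list_ub (l : list R) (d x : R) : In x l -> x <= max_list l d.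
Proof.
  induction l as [|y l IH]; simpl; [tauto|]. intros [->|H].
  - apply Rmax_l.
  - eapply Rle_trans; [apply IH, H|apply Rmax_r].
Qed.

Lemma max_list_attained (l : list R) (d : R) : max_list l d = d \/ In (max_list l d) l.
Proof.
  induction l as [|y l IH]; simpl; [now left|].
  unfold Rmax. destruct (Rle_dec y (max_list l d)); [|now right; left].
  destruct IH; [now left|now right; right].
Qed.

Lemma min_list_lb (l : list R) (d x : R) : In x l -> min_list l d <= x.
Proof.
  induction l as [|y l IH]; simpl; [tauto|]. intros [->|H].
  - apply Rmin_l.
  - eapply Rle_trans; [apply Rmin_r|apply IH, H].
Qed.

Lemma min_list_attained (l : list R) (d : R) : min_list l d = d \/ In (min_list l d) l.
Proof.
  induction l as [|y l IH]; simpl; [now left|].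
  unfold Rmin. destruct (Rle_dec y (min_list l d)); [now right; left|].
  destruct IH; [now left|now right; right].
Qed.

Lemma disjb_sym (a b : nat -> nat) (i j : nat) : disjb a b i j = disjb a b j i.
Proof.
  unfold disjb.
  now destruct (b i <=? a j)%nat, (b j <=? a i)%nat, (b i <=? a i)%nat, (b j <=? a j)%nat.
Qed.

Lemma feasible_iff (n : nat) (a b : nat -> nat) (S : nat -> bool) :
  feasible n a b S <->
  forall i j, (i < n)%nat -> (j < n)%nat -> S i = true -> S j = true -> i <> j ->
    disjb a b i j = true.
Proof.
  unfold feasible, feasibleb. rewrite forallb_forall. split.
  - intros H i j Hi Hj Si Sj Hij.
    specialize (H i ltac:(apply in_seq; lia)). rewrite forallb_forall in H.
    specialize (H j ltac:(apply in_seq; lia)). rewrite Si, Sj in H.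
    now rewrite (proj2 (Nat.eqb_neq i j) Hij) in H.
  - intros H i Hi. rewrite forallb_forall. intros j Hj.
    apply in_seq in Hi. apply in_seq in Hj.
    destruct (S i) eqn:Si, (S j) eqn:Sj, (Nat.eqb_spec i j); simpl; try reflexivity.
    apply H; lia || assumption.
Qed.

Lemma sum_change_one (g h : nat -> R) (l : list nat) (f : nat) :
  NoDup l -> In f l -> (forall j, In j l -> j <> f -> g j = h j) ->
  fold_right Rplus 0 (map g l) - g f = fold_right Rplus 0 (map h l) - h f.
Proof.
  induction l as [|x l IH]; simpl; [tauto|]. intros ND Hin E.
  inversion ND as [|? ? Hx ND']; subst.
  destruct (Nat.eq_dec x f) as [->|Hxf].
  - assert (map g l = map h l) as ->; [|lra].
    apply map_ext_in. intros j Hj. apply E; [now right|]. intros ->. tauto.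
  - rewrite (E x) by auto. destruct Hin as [|Hin]; [congruence|].
    specialize (IH ND' Hin ltac:(auto)). lra.
Qed.

(** Subtracting the term of [f] on both sides lets one statement serve insertion, deletion and no
    change at all. *)
Lemma weight_change_one (n : nat) (w : nat -> R) (S T : nat -> bool) (f : nat) :
  (f < n)%nat -> (forall j, (j < n)%nat -> j <> f -> S j = T j) ->
  weight n w S - (if S f then w f else 0) = weight n w T - (if T f then w f else 0).
Proof.
  intros Hf E. unfold weight.
  apply (sum_change_one (fun j => if S j then w j else 0) (fun j => if T j then w j else 0)).
  - apply seq_NoDup.
  - apply in_seq; lia.
  - intros j Hj Hjf. apply in_seq in Hj. now rewrite E by lia.
Qed.

Lemma weight_ext (n : nat) (w w' : nat -> R) (S T : nat -> bool) :
  (forall j, (j < n)%nat -> S j = T j) -> (forall j, (j < n)%nat -> w j = w' j) ->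
  weight n w S = weight n w' T.
Proof.
  intros E F. unfold weight. f_equal. apply map_ext_in. intros j Hj.
  apply in_seq in Hj. now rewrite E, F by lia.
Qed.

(* The job index [n] plays the role of the empty choice. *)
Definition job_option (n f : nat) : option nat := if (f <? n)%nat then Some f else None.

Definition deleted_weight (n : nat) (w : nat -> R) (S : nat -> bool) (f : nat) : R :=
  if (f <? n)%nat && S f then w f else 0.

(** For [f = n] the restriction [j <> f] is vacuous, so [replacement n a b S n e] says that [e] can
    be added to [S] itself. The condition [e <> f] matters even when [f] lies outside [S]: a failed
    job may not be chosen. *)
Definition replacement (n : nat) (a b : nat -> nat) (S : nat -> bool) (f e : nat) : Prop :=
  e = n \/
  ((e < n)%nat /\ S e = false /\ e <> f /\
   forall j, (j < n)%nat -> S j = true -> j <> f -> disjb a b j e = true).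

Lemma weight_delete (n : nat) (w : nat -> R) (S : nat -> bool) (f : nat) :
  weight n w (modify S (job_option n f) None) = weight n w S - deleted_weight n w S f.
Proof.
  unfold deleted_weight, job_option. destruct (Nat.ltb_spec f n) as [Hf|Hf]; simpl.
  - assert (E := weight_change_one n w (modify S (Some f) None) S f Hf).
    unfold modify in E at 3. rewrite Nat.eqb_refl, andb_false_r in E. simpl in E.
    rewrite <- E; [lra|]. intros j Hj Hjf. unfold modify.
    now rewrite (proj2 (Nat.eqb_neq f j)), andb_true_r, orb_false_r by auto.
  - rewrite Rminus_0_r. apply weight_ext; [|reflexivity]. intros j _. unfold modify.
    now rewrite andb_true_r, orb_false_r.
Qed.

Lemma weight_replace (n : nat) (w : nat -> R) (S : nat -> bool) (f e : nat) :
  (e < n)%nat -> S e = false ->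
  weight n w (modify S (job_option n f) (Some e)) =
  weight n w S - deleted_weight n w S f + w e.
Proof.
  intros He Se. rewrite <- weight_delete.
  assert (E := weight_change_one n w (modify S (job_option n f) (Some e))
                 (modify S (job_option n f) None) e He).
  assert (modify S (job_option n f) (Some e) e = true) as E1.
  { unfold modify. now rewrite Nat.eqb_refl, orb_true_r. }
  assert (modify S (job_option n f) None e = false) as E2.
  { unfold modify. now rewrite Se. }
  rewrite E1, E2 in E. rewrite Rminus_0_r in E. rewrite <- E; [lra|].
  intros j Hj Hje. unfold modify. now rewrite (proj2 (Nat.eqb_neq e j)) by auto.
Qed.

Lemma feasible_replace (n : nat) (a b : nat -> nat) (S : nat -> bool) (f e : nat) :
  feasible n a b S -> (f <= n)%nat -> (e < n)%nat -> S e = false -> e <> f ->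
  (feasible n a b (modify S (job_option n f) (Some e)) <->
   forall j, (j < n)%nat -> S j = true -> j <> f -> disjb a b j e = true).
Proof.
  intros FS Hf He Se Hef. rewrite feasible_iff in *.
  assert (M : forall j, (j < n)%nat -> modify S (job_option n f) (Some e) j = true <->
     ((S j = true /\ j <> f) \/ j = e)).
  { intros j Hj. unfold modify, job_option.
    destruct (Nat.ltb_spec f n).
    - destruct (S j), (Nat.eqb_spec f j), (Nat.eqb_spec e j); simpl;
        split; intros; subst; try tauto; try congruence; intuition congruence.
    - assert (f <> j) by lia.
      destruct (S j), (Nat.eqb_spec e j); simpl;
        split; intros; subst; try tauto; try congruence; intuition congruence. }
  split.
  - intros H j Hj Sj Hjf. apply H; try assumption; [apply M..|]; auto. congruence.
  - intros H i j Hi Hj Mi Mj Hij. apply M in Mi; [|assumption]. apply M in Mj; [|assumption].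
    destruct Mi as [[Si Hif]| ->], Mj as [[Sj Hjf]| ->]; try congruence.
    + now apply FS.
    + now apply H.
    + rewrite disjb_sym. now apply H.
Qed.

(** Together with [recovery_attained] this trades the list maximum for arithmetic: recovery is the
    largest [weight n w S - deleted_weight n w S f + w e] over all replacements [e], the dummy
    included. *)
Lemma recovery_ge (n : nat) (a b : nat -> nat) (w : nat -> R) (S : nat -> bool) (f e : nat) :
  w n = 0 -> feasible n a b S -> (f <= n)%nat -> replacement n a b S f e ->
  weight n w S - deleted_weight n w S f + w e <= recovery n a b w S (job_option n f).
Proof.
  intros W0 FS Hf [->|(He & Se & Hef & H)]; unfold recovery.
  - rewrite W0, Rplus_0_r, <- weight_delete. apply max_list_ub. now left.
  - rewrite <- weight_replace by assumption. apply max_list_ub.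
    apply (in_map (fun e => weight n w (modify S (job_option n f) e)) _ (Some e)).
    right. apply filter_In. split; [apply in_map, in_seq; lia|].
    rewrite Se. replace (match job_option n f with Some i => (i =? e)%nat | None => false end)
      with false.
    + simpl. now apply feasible_replace.
    + unfold job_option. destruct (f <? n)%nat; [|reflexivity].
      symmetry. apply Nat.eqb_neq. auto.
Qed.

Lemma recovery_attained (n : nat) (a b : nat -> nat) (w : nat -> R) (S : nat -> bool) (f : nat) :
  w n = 0 -> feasible n a b S -> (f <= n)%nat ->
  exists e, replacement n a b S f e /\
    recovery n a b w S (job_option n f) = weight n w S - deleted_weight n w S f + w e.
Proof.
  intros W0 FS Hf. unfold recovery.
  assert (N : exists e, replacement n a b S f e /\ weight n w (modify S (job_option n f) None) =
     weight n w S - deleted_weight n w S f + w e).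
  { exists n. split; [now left|]. rewrite weight_delete, W0. lra. }
  edestruct max_list_attained as [E|E]; [rewrite E; exact N|].
  apply in_map_iff in E. destruct E as (e & E & Hin). rewrite <- E.
  destruct Hin as [<-|Hin]; [exact N|].
  apply filter_In in Hin. destruct Hin as [Hin He].
  apply in_map_iff in Hin. destruct Hin as (e' & <- & Hin). apply in_seq in Hin.
  apply andb_true_iff in He. destruct He as [He Fe].
  apply andb_true_iff in He. destruct He as [He Hef].
  apply negb_true_iff in He. apply negb_true_iff in Hef.
  assert (e' <> f) as Hef'.
  { intros ->. unfold job_option in Hef. rewrite (proj2 (Nat.ltb_lt f n)) in Hef by lia.
    rewrite Nat.eqb_refl in Hef. discriminate. }
  exists e'. split; [|apply weight_replace; lia || assumption].
  right. repeat split; try lia; try assumption. now apply feasible_replace.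
Qed.

Lemma robust_value_le (n : nat) (a b : nat -> nat) (w : nat -> R) (S : nat -> bool) (f : nat) :
  (f <= n)%nat -> robust_value n a b w S <= recovery n a b w S (job_option n f).
Proof.
  intros Hf. apply min_list_lb. apply in_map. unfold job_option.
  destruct (Nat.ltb_spec f n); [right; apply in_map, in_seq; lia|now left].
Qed.

Lemma robust_value_attained (n : nat) (a b : nat -> nat) (w : nat -> R) (S : nat -> bool) :
  exists f, (f <= n)%nat /\ robust_value n a b w S = recovery n a b w S (job_option n f).
Proof.
  assert (N : job_option n n = None) by (unfold job_option; now rewrite Nat.ltb_irrefl).
  unfold robust_value. edestruct min_list_attained as [E|E]; [rewrite E|].
  - exists n. now rewrite N.
  - apply in_map_iff in E. destruct E as (f & E & Hin). rewrite <- E.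
    destruct Hin as [<-|Hin]; [exists n; now rewrite N|].
    apply in_map_iff in Hin. destruct Hin as (f' & <- & Hin). apply in_seq in Hin.
    exists f'. unfold job_option. rewrite (proj2 (Nat.ltb_lt f' n)) by lia. split; [lia|reflexivity].
Qed.

Lemma forallb_ext_in {A : Type} (f g : A -> bool) (l : list A) :
  (forall x, In x l -> f x = g x) -> forallb f l = forallb g l.
Proof.
  induction l as [|x l IH]; simpl; [reflexivity|]. intros H.
  rewrite H by now left. f_equal. apply IH. auto.
Qed.

Lemma feasibleb_ext (n : nat) (a b a' b' : nat -> nat) (S T : nat -> bool) :
  (forall j, (j < n)%nat -> a j = a' j /\ b j = b' j /\ S j = T j) ->
  feasibleb n a b S = feasibleb n a' b' T.
Proof.
  intros E. apply forallb_ext_in. intros i Hi. apply forallb_ext_in. intros j Hj.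
  apply in_seq in Hi. apply in_seq in Hj. unfold disjb.
  destruct (E i ltac:(lia)) as (-> & -> & ->). now destruct (E j ltac:(lia)) as (-> & -> & ->).
Qed.

(** Needed because the RAM works on a padded instance and delivers a predicate that agrees with the
    computed set only below [n]. *)
Lemma robust_value_ext (n : nat) (a b a' b' : nat -> nat) (w w' : nat -> R) (S T : nat -> bool) :
  (forall j, (j < n)%nat -> a j = a' j /\ b j = b' j /\ w j = w' j /\ S j = T j) ->
  robust_value n a b w S = robust_value n a' b' w' T.
Proof.
  intros E.
  assert (EW : forall f e, weight n w (modify S f e) = weight n w' (modify T f e)).
  { intros f e. apply weight_ext; intros j Hj; [|now apply E].
    unfold modify. now destruct (E j Hj) as (_ & _ & _ & ->). }
  assert (ER : forall f, recovery n a b w S f = recovery n a' b' w' T f).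
  { intros f. unfold recovery. rewrite EW.
    assert (adm_e n a b S f = adm_e n a' b' T f) as ->.
    { unfold adm_e. f_equal. apply filter_ext_in. intros e He.
      apply in_map_iff in He. destruct He as (j & <- & Hj). apply in_seq in Hj.
      destruct (E j ltac:(lia)) as (_ & _ & _ & ->). f_equal.
      apply feasibleb_ext. intros i Hi. unfold modify.
      destruct (E i Hi) as (-> & -> & _ & ->). auto. }
    f_equal. apply map_ext. intros e. apply EW. }
  unfold robust_value. rewrite ER. f_equal. apply map_ext. apply ER.
Qed.

(** * Chains of items *)

Lemma disjb_iff (a b : nat -> nat) (i j : nat) :
  disjb a b i j = true <-> (b i <= a j \/ b j <= a i \/ b i <= a i \/ b j <= a j)%nat.
Proof. unfold disjb. rewrite !orb_true_iff, !Nat.leb_le. tauto. Qed.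

(** [P] is an arbitrary predicate, hence the classical case split. The index [n] satisfies [P], so
    it starts the search and stays a competitor throughout the induction. *)
Lemma bounded_argmax (P : nat -> Prop) (w : nat -> R) (n : nat) :
  P n -> exists e, (e <= n)%nat /\ P e /\ forall e', (e' <= n)%nat -> P e' -> w e' <= w e.
Proof.
  intros Pn.
  assert (H : forall k, (k <= n)%nat -> exists e, (e <= n)%nat /\ P e /\
     forall e', (e' < k \/ e' = n)%nat -> P e' -> w e' <= w e).
  { induction k as [|k IH]; intros Hk.
    - exists n. repeat split; auto. intros e' [He'| ->]; [lia|]. lra.
    - destruct IH as (e & He & Pe & Hmax); [lia|].
      destruct (classic (P k /\ w e < w k)) as [[Pk Hlt]|Hno].
      + exists k. repeat split; [lia|assumption|]. intros e' He' Pe'.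
        destruct (Nat.eq_dec e' k) as [->|]; [lra|].
        specialize (Hmax e' ltac:(lia) Pe'). lra.
      + exists e. repeat split; [lia|assumption|]. intros e' He' Pe'.
        destruct (Nat.eq_dec e' k) as [->|]; [|apply Hmax; lia || assumption].
        apply Rnot_lt_le. tauto. }
  destruct (H n (le_n n)) as (e & He & Pe & Hmax).
  exists e. repeat split; auto. intros e' He'. apply Hmax. lia.
Qed.

Section Chains.
Variables (n : nat) (a b : nat -> nat) (w : nat -> R).

(* [l] is the guessed loss, and [e1], [e2] are the guessed addable jobs. *)
Definition guess_ok (l : R) (e1 e2 : nat) : Prop :=
  (e1 <= n)%nat /\ (e2 <= n)%nat /\ (e1 <> e2 \/ e1 = n) /\ 0 <= l + w e1 /\ 0 <= l + w e2.

(* An item [(f, e)] says that [f] is in the solution and is replaced by [e] when it fails. *)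
Definition item_ok (X : nat -> bool) (l : R) (e1 e2 : nat) (q : nat * nat) : Prop :=
  let (f, e) := q in
  (f < n)%nat /\ (e <= n)%nat /\ X f = true /\ f <> e1 /\ f <> e2 /\
  disjb a b f e1 = true /\ disjb a b f e2 = true /\
  e <> f /\ w f <= l + w e /\ (e = e1 \/ (a f < b f /\ a e < b e)%nat).

(* Empty jobs come first, by index, then the nonempty ones from left to right; a replacement
   other than [e1] has to fit between the neighbours of the job that it replaces. *)
Definition link (e1 : nat) (q q' : nat * nat) : Prop :=
  let (f, e) := q in
  let (f', e') := q' in
  ((b f <= a f /\ (a f' < b f' \/ f < f')) \/
   (a f < b f /\ a f' < b f' /\ b f <= a f' /\
    (e = e1 \/ b e <= a f') /\ (e' = e1 \/ b f <= a e')))%nat.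

(* The last item of the chain is the head of the list. *)
Inductive chain (X : nat -> bool) (l : R) (e1 e2 : nat) : list (nat * nat) -> Prop :=
| chain_nil : chain X l e1 e2 []
| chain_cons q L : item_ok X l e1 e2 q -> Forall (fun q' => link e1 q' q) L ->
    chain X l e1 e2 L -> chain X l e1 e2 (q :: L).

Definition chain_weight (L : list (nat * nat)) : R :=
  fold_right (fun q s => w (fst q) + s) 0 L.

(** Bridges two views of a path: [chain] demands a link from every earlier item, whereas a
    relaxation checks only the current last one. Among nonempty jobs it holds because the middle job
    separates the outer two together with their replacements. *)
Lemma link_trans (e1 : nat) (q1 q2 q3 : nat * nat) :
  link e1 q1 q2 -> link e1 q2 q3 -> link e1 q1 q3.
Proof. destruct q1 as [f1 g1], q2 as [f2 g2], q3 as [f3 g3]. simpl. intros H1 H2.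
  destruct H1 as [H1|H1]; [left|right]; lia. Qed.

Lemma chain_extend X l e1 e2 q q' L :
  chain X l e1 e2 (q :: L) -> item_ok X l e1 e2 q' -> link e1 q q' ->
  chain X l e1 e2 (q' :: q :: L).
Proof.
  intros C Hq' Hl. constructor; [assumption| |assumption].
  inversion C as [|? ? ? F]; subst. constructor; [assumption|].
  eapply Forall_impl; [|exact F]. intros x Hx. exact (link_trans _ _ _ _ Hx Hl).
Qed.

Lemma chain_items_ok X l e1 e2 L :
  chain X l e1 e2 L -> Forall (item_ok X l e1 e2) L.
Proof. induction 1; constructor; assumption. Qed.

Lemma chain_pairwise X l e1 e2 L q q' :
  chain X l e1 e2 L -> In q L -> In q' L -> q = q' \/ link e1 q q' \/ link e1 q' q.
Proof.
  induction 1 as [|x L Hx F C IH]; simpl; [tauto|]. rewrite Forall_forall in F.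
  intros [->|Hq] [->|Hq']; auto.
Qed.

Lemma link_fst_neq e1 q q' : link e1 q q' -> fst q <> fst q'.
Proof. destruct q, q'. simpl. intros H ->. lia. Qed.

Lemma link_disjoint e1 q q' : link e1 q q' -> disjb a b (fst q) (fst q') = true.
Proof. destruct q, q'. simpl. rewrite disjb_iff. lia. Qed.

Lemma chain_NoDup X l e1 e2 L : chain X l e1 e2 L -> NoDup (map fst L).
Proof.
  induction 1 as [|q L Hq F C IH]; simpl; constructor; [|assumption].
  intros Hin. apply in_map_iff in Hin. destruct Hin as (q' & E & Hin).
  rewrite Forall_forall in F. apply (link_fst_neq _ _ _ (F q' Hin)). assumption.
Qed.

(** Linked items have different first components, so the graph is acyclic; this bounds the number of
    relaxation rounds. *)
Lemma chain_length X l e1 e2 L : chain X l e1 e2 L -> (length L <= n)%nat.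
Proof.
  intros C. rewrite <- (length_map fst), <- (length_seq n 0).
  apply NoDup_incl_length; [eapply chain_NoDup, C|].
  intros f Hf. apply in_map_iff in Hf. destruct Hf as ([f' e] & <- & Hin).
  apply chain_items_ok in C. rewrite Forall_forall in C. apply C in Hin.
  apply in_seq. simpl in *. lia.
Qed.

Definition chain_set (L : list (nat * nat)) (j : nat) : bool :=
  existsb (fun q => (fst q =? j)%nat) L.

Lemma chain_set_iff L j : chain_set L j = true <-> exists e, In (j, e) L.
Proof.
  unfold chain_set. rewrite existsb_exists. split.
  - intros ([f e] & Hin & E). apply Nat.eqb_eq in E. simpl in E. subst. eauto.
  - intros (e & Hin). exists (j, e). split; [assumption|]. apply Nat.eqb_refl.
Qed.

Lemma chain_set_weight X l e1 e2 L :
  chain X l e1 e2 L -> weight n w (chain_set L) = chain_weight L.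
Proof.
  intros C. assert (ND := chain_NoDup _ _ _ _ _ C). induction C as [|q L Hq F C IH]; simpl.
  - unfold weight. clear. induction (seq 0 n) as [|x s IH]; simpl in *; [reflexivity|].
    rewrite IH. lra.
  - inversion ND as [|? ? Hn ND']; subst. rewrite <- IH by assumption.
    assert (Hlt : (fst q < n)%nat) by (destruct q; apply Hq).
    assert (E1 : chain_set (q :: L) (fst q) = true)
      by (unfold chain_set; simpl; now rewrite Nat.eqb_refl).
    assert (E2 : chain_set L (fst q) = false).
    { destruct (chain_set L (fst q)) eqn:E; [|reflexivity].
      apply chain_set_iff in E. destruct E as (e & Hin).
      exfalso. apply Hn. change (fst q) with (fst (fst q, e)). now apply in_map. }
    assert (E := weight_change_one n w (chain_set (q :: L)) (chain_set L) (fst q) Hlt).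
    rewrite E1, E2 in E. rewrite Rminus_0_r in E. rewrite <- E; [lra|].
    intros j _ Hj. unfold chain_set. simpl. now rewrite (proj2 (Nat.eqb_neq _ _)) by auto.
Qed.

Hypothesis dummy_empty : (b n <= a n)%nat.
Hypothesis dummy_weight : w n = 0.
Hypothesis w_nonneg : forall j, 0 <= w j.

(** Every guess passing [guess_ok] is safe: [item_ok] keeps the jobs of the chain away from [e1] and
    [e2], so both remain addable, and each failure gets an explicit reply that loses at most [l]. *)
Lemma chain_sound X l e1 e2 L :
  guess_ok l e1 e2 -> chain X l e1 e2 L ->
  exists S, feasible n a b S /\ (forall j, (j < n)%nat -> S j = true -> X j = true) /\
    chain_weight L - l <= robust_value n a b w S.
Proof.
  intros (He1 & He2 & H12 & Hl1 & Hl2) C. exists (chain_set L).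
  assert (OK := chain_items_ok _ _ _ _ _ C). rewrite Forall_forall in OK.
  assert (FS : feasible n a b (chain_set L)).
  { apply feasible_iff. intros i j _ _ Si Sj Hij.
    apply chain_set_iff in Si, Sj. destruct Si as (ei & Hi), Sj as (ej & Hj).
    destruct (chain_pairwise _ _ _ _ _ _ _ C Hi Hj) as [E|[E|E]]; [congruence| |].
    - apply (link_disjoint _ _ _ E).
    - rewrite disjb_sym. apply (link_disjoint _ _ _ E). }
  (* The guessed jobs are admissible replies to every failure other than their own; the dummy is
     admissible always. *)
  assert (A : forall e f, (e = e1 \/ e = e2) -> e <> f \/ e = n ->
    replacement n a b (chain_set L) f e).
  { intros e f He Hef. destruct (Nat.eq_dec e n) as [->|Hen]; [now left|]. right.
    repeat split; [destruct He; lia| |tauto|].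
    - destruct (chain_set L e) eqn:E; [|reflexivity]. apply chain_set_iff in E.
      destruct E as (e' & Hin). apply OK in Hin. simpl in Hin. destruct He; intuition congruence.
    - intros j Hj Sj Hjf. apply chain_set_iff in Sj. destruct Sj as (e' & Hin).
      apply OK in Hin. simpl in Hin. destruct He as [->| ->]; tauto. }
  split; [assumption|]. split.
  { intros j Hj Sj. apply chain_set_iff in Sj. destruct Sj as (e & Hin). apply OK in Hin.
    apply Hin. }
  rewrite <- (chain_set_weight _ _ _ _ _ C).
  destruct (robust_value_attained n a b w (chain_set L)) as (f & Hf & ->).
  (* The reply is the recorded partner for a job of the chain, otherwise [e1], or [e2] when [e1] is
     what failed. *)
  assert (G : exists e, replacement n a b (chain_set L) f e /\
    deleted_weight n w (chain_set L) f <= l + w e).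
  { unfold deleted_weight. destruct (Nat.ltb_spec f n) as [Hfn|Hfn]; simpl.
    - destruct (chain_set L f) eqn:Sf.
      + apply chain_set_iff in Sf. destruct Sf as (e & Hin). assert (Hq := OK _ Hin).
        simpl in Hq. destruct Hq as (_ & Hle & _ & Hf1 & Hf2 & D1 & D2 & Hef & Hw & He).
        exists e. split; [|assumption].
        destruct (Nat.eq_dec e e1) as [->|Hne]; [apply A; auto|].
        destruct He as [|[Nf Ne]]; [congruence|].
        assert (Hen : (e < n)%nat) by (assert (e <> n) by (intros ->; lia); lia).
        right. repeat split; [assumption| |assumption|].
        (* Were [e] itself in the chain, its link with [(f, e)] would make the nonempty interval of
           [e] end no later than it starts. *)
        * destruct (chain_set L e) eqn:Se; [|reflexivity].
             apply chain_set_iff in Se. destruct Se as (e' & Hin').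
             destruct (chain_pairwise _ _ _ _ _ _ _ C Hin Hin') as [E|E]; [congruence|].
             simpl in E. lia.
        * intros j Hj Sj Hjf. apply chain_set_iff in Sj. destruct Sj as (e' & Hin').
             destruct (chain_pairwise _ _ _ _ _ _ _ C Hin Hin') as [E|E]; [congruence|].
             simpl in E. rewrite disjb_iff. lia.
      + destruct (Nat.eq_dec e1 f) as [->|Hne].
        * exists e2. split; [|lra]. apply A; auto. left. destruct H12; [auto|lia].
        * exists e1. split; [|lra]. apply A; auto.
    - exists e1. split; [|lra]. apply A; [auto|]. lia. }
  destruct G as (e & He & Hw).
  assert (R := recovery_ge n a b w (chain_set L) f e dummy_weight FS Hf He). lra.
Qed.

(** Insertion sort: as soon as [q] can follow the current last item it follows all earlier ones by
    transitivity, so pairwise comparability is enough to build a chain. *)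
Lemma chain_insert X l e1 e2 q L :
  item_ok X l e1 e2 q -> chain X l e1 e2 L ->
  Forall (fun q' => link e1 q q' \/ link e1 q' q) L ->
  exists L', Permutation (q :: L) L' /\ chain X l e1 e2 L'.
Proof.
  intros Hq C. revert q Hq. induction C as [|x L Hx F C IH]; intros q Hq Hc.
  - exists [q]. split; [reflexivity|]. repeat constructor. assumption.
  - inversion Hc as [|? ? [Hqx|Hxq] Hc']; subst.
    + destruct (IH q Hq Hc') as (L' & P & C'). exists (x :: L'). split.
      * rewrite perm_swap. now constructor.
      * constructor; [assumption| |assumption]. rewrite <- P. now constructor.
    + exists (q :: x :: L). split; [reflexivity|].
      apply chain_extend; try assumption. now constructor.
Qed.

Lemma weight_filter S : weight n w S = fold_right (fun f s => w f + s) 0 (filter S (seq 0 n)).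
Proof.
  unfold weight. induction (seq 0 n) as [|x s IH]; simpl; [reflexivity|].
  rewrite IH. destruct (S x); simpl; lra.
Qed.

(** The guesses are read off from [S]: the loss from a worst failure and its best reply, [e1] and
    [e2] as the heaviest addable jobs. Every job of [S] then has a partner, and any two of the
    resulting items are linked in one direction. *)
Lemma chain_complete X S :
  feasible n a b S -> (forall j, (j < n)%nat -> S j = true -> X j = true) ->
  exists f0 e0 e1 e2 L, (f0 <= n)%nat /\ (e0 <= n)%nat /\
    guess_ok (w f0 - w e0) e1 e2 /\ chain X (w f0 - w e0) e1 e2 L /\
    robust_value n a b w S = chain_weight L - (w f0 - w e0).
Proof.
  intros FS SX.
  assert (REC : forall f, (f <= n)%nat -> exists e, (e <= n)%nat /\ replacement n a b S f e /\
     recovery n a b w S (job_option n f) = weight n w S - deleted_weight n w S f + w e).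
  { intros f Hf. destruct (recovery_attained n a b w S f dummy_weight FS Hf) as (e & He & E).
    exists e. repeat split; try assumption. destruct He as [->|[He _]]; lia. }
  (* A failure outside [S] deletes no weight, so the dummy takes the place of [f0] in that case. *)
  assert (LOSS : exists f0 e0, (f0 <= n)%nat /\ (e0 <= n)%nat /\
     robust_value n a b w S = weight n w S - (w f0 - w e0)).
  { destruct (robust_value_attained n a b w S) as (f & Hf & E).
    destruct (REC f Hf) as (e & He & _ & E'). rewrite E, E'. unfold deleted_weight.
    destruct ((f <? n)%nat && S f);
      [exists f, e|exists n, e; rewrite dummy_weight]; repeat split; auto; lra. }
  destruct LOSS as (f0 & e0 & Hf0 & He0 & EL). set (l := w f0 - w e0) in *.
  destruct (bounded_argmax (fun e => replacement n a b S n e) w n) as (e1 & He1 & R1 & M1);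
    [now left|].
  (* The alternative [e = n] provides a candidate even if [e1] is already the dummy. *)
  destruct (bounded_argmax (fun e => e = n \/ (replacement n a b S n e /\ e <> e1)) w n)
    as (e2 & He2 & R2 & M2); [now left|].
  assert (DN : deleted_weight n w S n = 0)
    by (unfold deleted_weight; now rewrite Nat.ltb_irrefl).
  assert (G1 : 0 <= l + w e1).
  { assert (H := robust_value_le n a b w S n (le_n n)).
    destruct (REC n (le_n n)) as (e & He & Re & E). specialize (M1 e He Re). lra. }
  (* The failure of [e1] deletes nothing but rules [e1] out, so its best reply is another addable
     job or the dummy, at most as heavy as [e2]. If [e1 = n], nonnegative weights suffice. *)
  assert (G2 : 0 <= l + w e2).
  { assert (H := robust_value_le n a b w S e1 He1).
    destruct (REC e1 He1) as (e & He & Re & E).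
    destruct R1 as [E1|(Hlt & S1 & _ & D1)].
    - rewrite E1, dummy_weight in G1. specialize (w_nonneg e2). lra.
    - assert (deleted_weight n w S e1 = 0) as DE
        by (unfold deleted_weight; now rewrite S1, andb_false_r).
      specialize (M2 e He). lapply M2; [lra|].
      destruct Re as [|(Hen & Se & Hne & De)]; [now left|]. right. split; [|assumption].
      right. repeat split; [assumption|assumption|lia|]. intros j Hj Sj _.
      apply De; [assumption..|]. congruence. }
  set (good q := item_ok X l e1 e2 q /\ S (fst q) = true /\
     (snd q = e1 \/ (disjb a b (fst q) (snd q) = false /\
        replacement n a b S (fst q) (snd q)))).
  assert (ADD1 : forall f, (f < n)%nat -> S f = true -> f <> e1 /\ disjb a b f e1 = true).
  { intros f Hf Sf. destruct R1 as [->|(Hlt & S1 & _ & D1)].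
    - split; [lia|]. apply disjb_iff. lia.
    - split; [congruence|]. apply D1; [assumption..|lia]. }
  assert (ADD2 : forall f, (f < n)%nat -> S f = true -> f <> e2 /\ disjb a b f e2 = true).
  { intros f Hf Sf. assert (R2' : replacement n a b S n e2)
      by (destruct R2 as [->|[R2 _]]; [now left|assumption]).
    destruct R2' as [->|(Hlt & S1 & _ & D1)].
    - split; [lia|]. apply disjb_iff. lia.
    - split; [congruence|]. apply D1; [assumption..|lia]. }
  assert (GOOD : forall f, (f < n)%nat -> S f = true -> exists e, good (f, e)).
  { intros f Hf Sf. destruct (ADD1 f Hf Sf) as [N1 D1]. destruct (ADD2 f Hf Sf) as [N2 D2].
    assert (H := robust_value_le n a b w S f ltac:(lia)).
    destruct (REC f ltac:(lia)) as (e & He & Re & E).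
    assert (Hw : w f <= l + w e).
    { unfold deleted_weight in E. rewrite (proj2 (Nat.ltb_lt f n) Hf), Sf in E. simpl in E. lra. }
    assert (USE1 : w e <= w e1 -> exists e, good (f, e)).
    { intros Hle. exists e1. split; [|simpl; auto].
      simpl. repeat split; auto. lra. }
    (* A reply disjoint from [f] is addable to all of [S], hence no heavier than [e1], which
       replaces it. Otherwise it overlaps [f], and both intervals are nonempty. *)
    destruct (disjb a b f e) eqn:D.
    - apply USE1. apply M1; [assumption|].
      destruct Re as [|(Hen & Se & Hne & De)]; [now left|right].
      repeat split; [assumption..|lia|]. intros j Hj Sj _.
      destruct (Nat.eq_dec j f) as [->|]; [assumption|now apply De].
    - assert (a f < b f /\ a e < b e)%nat as [Nf Ne].
      { rewrite <- not_true_iff_false, disjb_iff in D. lia. }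
      exists e. split; [|simpl; auto]. simpl. repeat split; auto.
      destruct Re as [->|(Hen & Se & Hne & De)]; [lia|assumption]. }
  (* An interval that meets [f] and misses [f'] lies on the same side of [f'] as [f]. Disjointness
     of [f] and [f'] thus also orders their recorded partners. *)
  assert (COMP : forall q q', good q -> good q' -> fst q <> fst q' ->
    link e1 q q' \/ link e1 q' q).
  { intros [f e] [f' e'] (O & Sf & K) (O' & Sf' & K') Hff'. simpl in *.
    rewrite feasible_iff in FS. destruct O as [Hf _], O' as [Hf' _].
    assert (D := FS f f' Hf Hf' Sf Sf' Hff').
    assert (KK : forall f e f', (f < n)%nat -> (f' < n)%nat -> f <> f' -> S f' = true ->
      (e = e1 \/ disjb a b f e = false /\ replacement n a b S f e) ->
      e = e1 \/ (disjb a b f e = false /\ disjb a b f' e = true)).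
    { intros g h g' Hg Hg' Hgg' Sg' [|[Df R]]; [now left|right]. split; [assumption|].
      destruct R as [->|(_ & _ & _ & R)]; [apply disjb_iff; lia|]. apply R; auto. }
    apply (KK f e f') in K; [|auto..]. apply (KK f' e' f) in K'; [|auto..].
    rewrite <- !not_true_iff_false, !disjb_iff in *. clear - D K K' Hff'.
    destruct (le_lt_dec (b f) (a f)), (le_lt_dec (b f') (a f')); [lia|lia|lia|].
    destruct D as [D|D]; [left; right|right; right; assert (b f' <= a f)%nat by lia];
      repeat split; try lia; (destruct K as [K|[K1 K2]]; [|clear K']); lia. }
  assert (BUILD : forall fs, NoDup fs -> (forall f, In f fs -> (f < n)%nat /\ S f = true) ->
    exists L, Permutation (map fst L) fs /\ Forall good L /\ chain X l e1 e2 L).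
  { induction fs as [|f fs IH]; intros ND Hin.
    - exists []. repeat constructor.
    - inversion ND as [|? ? Hf ND']; subst.
      destruct IH as (L & P & GL & C); [assumption|intros g Hg; apply Hin; now right|].
      destruct (GOOD f) as (e & Gq); [apply Hin; now left..|].
      destruct (chain_insert X l e1 e2 (f, e) L) as (L' & P' & C').
      + apply Gq.
      + assumption.
      + rewrite Forall_forall in *. intros q' Hq'. apply COMP; auto.
        intros E. apply Hf. rewrite <- P. simpl in E. rewrite E. now apply in_map.
      + exists L'. repeat split; [|rewrite <- P'; now constructor|assumption].
        rewrite <- P'. simpl. now constructor. }
  destruct (BUILD (filter S (seq 0 n))) as (L & P & GL & C).
  { apply NoDup_filter, seq_NoDup. }
  { intros f Hf. apply filter_In in Hf. destruct Hf as [Hf Sf]. apply in_seq in Hf.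
    split; [lia|assumption]. }
  exists f0, e0, e1, e2, L. fold l. repeat split; auto.
  - destruct R2 as [->|[_ R2]]; [|auto].
    destruct (Nat.eq_dec e1 n); auto.
  - rewrite EL, weight_filter. f_equal.
    assert (PS : forall x y : list nat, Permutation x y ->
      fold_right (fun f s => w f + s) 0 x = fold_right (fun f s => w f + s) 0 y).
    { induction 1; simpl; lra. }
    rewrite <- (PS _ _ P). clear. induction L as [|q L IH]; simpl; [reflexivity|].
    now rewrite IH.
Qed.
End Chains.

(** * A loop language *)

(* Loops run over [0..n], so that every index may also denote the dummy job [n].  A loop at
   nesting depth [k] binds the variable [k], which commands cannot assign. *)
Inductive natexp : Type :=
| Level (k : nat)
| JobCount
| StartOf (k : nat)
| EndOf (k : nat).

Inductive realexp : Type :=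
| Zero
| WeightOf (k : nat)
| Table (k l : nat)
| Scalar (c : nat)
| Plus (x y : realexp)
| Minus (x y : realexp).

Inductive boolexp : Type :=
| LeNat (x y : natexp)
| LeReal (x y : realexp)
| Member (k : nat)
| Not (x : boolexp)
| And (x y : boolexp)
| Or (x y : boolexp).

Inductive cmd : Type :=
| Skip
| Seq (c d : cmd)
| If (x : boolexp) (c d : cmd)
| For (c : cmd)
| SetScalar (c : nat) (x : realexp)
| SetTable (k l : nat) (x : realexp)
| SetMember (k : nat) (v : bool).

Record store : Type :=
  mkStore { members : nat -> bool; table : nat -> nat -> R; scalars : nat -> R }.

Fixpoint loop {A : Type} (k : nat) (f : nat -> A -> A) (s : A) : A :=
  match k with O => s | S k => f k (loop k f s) end.

Lemma loop_inv {A : Type} (I : nat -> A -> Prop) k f s :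
  I 0%nat s -> (forall i t, (i < k)%nat -> I i t -> I (S i) (f i t)) -> I k (loop k f s).
Proof. intros H0 HS. induction k as [|k IH]; simpl; [assumption|]. apply HS; auto. Qed.

Lemma loop_const_inv {A : Type} (I : A -> Prop) k f s :
  I s -> (forall i t, (i < k)%nat -> I t -> I (f i t)) -> I (loop k f s).
Proof. intros. now apply (loop_inv (fun _ => I)). Qed.

(** For goals about one particular index: iteration [i0] establishes [Q], all others preserve it,
    and [I] holds throughout. Applied once per level of a nested loop, it singles out one tuple of
    indices. *)
Lemma loop_reach {A : Type} (I Q : A -> Prop) k f s i0 :
  (i0 < k)%nat -> I s -> (forall i t, (i < k)%nat -> I t -> I (f i t)) ->
  (forall i t, (i < k)%nat -> I t /\ Q t -> I (f i t) /\ Q (f i t)) ->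
  (forall t, I t -> I (f i0 t) /\ Q (f i0 t)) -> I (loop k f s) /\ Q (loop k f s).
Proof.
  intros Hi0 Is HI HQ H0. induction k as [|k IH]; [lia|]. simpl.
  destruct (Nat.eq_dec i0 k) as [->|Hne].
  - apply H0. apply loop_const_inv; auto.
  - apply HQ; [lia|]. apply IH; auto. lia.
Qed.

Definition Rleb (x y : R) : bool := if Rle_dec x y then true else false.

Lemma Rleb_iff x y : Rleb x y = true <-> x <= y.
Proof. unfold Rleb. destruct (Rle_dec x y); split; auto; discriminate. Qed.

Section Semantics.
Variables (n : nat) (a b : nat -> nat) (w : nat -> R).

Definition eval_nat (v : nat -> nat) (x : natexp) : nat :=
  match x with
  | Level k => v k
  | JobCount => n
  | StartOf k => a (v k)
  | EndOf k => b (v k)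
  end.

Fixpoint eval_real (v : nat -> nat) (s : store) (x : realexp) : R :=
  match x with
  | Zero => 0
  | WeightOf k => w (v k)
  | Table k l => table s (v k) (v l)
  | Scalar c => scalars s c
  | Plus x y => eval_real v s x + eval_real v s y
  | Minus x y => eval_real v s x - eval_real v s y
  end.

Fixpoint eval_bool (v : nat -> nat) (s : store) (x : boolexp) : bool :=
  match x with
  | LeNat x y => (eval_nat v x <=? eval_nat v y)%nat
  | LeReal x y => Rleb (eval_real v s x) (eval_real v s y)
  | Member k => members s (v k)
  | Not x => negb (eval_bool v s x)
  | And x y => eval_bool v s x && eval_bool v s y
  | Or x y => eval_bool v s x || eval_bool v s y
  end.

Fixpoint run (d : nat) (c : cmd) (v : nat -> nat) (s : store) : store :=
  match c with
  | Skip => s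
  | Seq c1 c2 => run d c2 v (run d c1 v s)
  | If x c1 c2 => if eval_bool v s x then run d c1 v s else run d c2 v s
  | For c => loop (S n) (fun i s => run (S d) c (upd v d i) s) s
  | SetScalar c x =>
      mkStore (members s) (table s) (upd (scalars s) c (eval_real v s x))
  | SetTable k l x =>
      mkStore (members s) (upd (table s) (v k) (upd (table s (v k)) (v l) (eval_real v s x)))
        (scalars s)
  | SetMember k x => mkStore (upd (members s) (v k) x) (table s) (scalars s)
  end.
End Semantics.

(** * The algorithm *)

Definition lt_nat (x y : natexp) : boolexp := Not (LeNat y x).
Definition eq_nat (x y : natexp) : boolexp := And (LeNat x y) (LeNat y x).
Definition nonempty (k : nat) : boolexp := lt_nat (StartOf k) (EndOf k).
Definition disjoint (k l : nat) : boolexp :=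
  Or (Or (Or (LeNat (EndOf k) (StartOf l)) (LeNat (EndOf l) (StartOf k)))
       (LeNat (EndOf k) (StartOf k))) (LeNat (EndOf l) (StartOf l)).

Declare Scope cmd_scope.
Delimit Scope cmd_scope with cmd.
Local Infix "&&" := And (at level 40, left associativity) : cmd_scope.
Local Infix "||" := Or (at level 50, left associativity) : cmd_scope.
Local Infix ";;" := Seq (at level 60, right associativity) : cmd_scope.
Local Open Scope cmd_scope.

(* Variables: 0 is the job under test, 1 and 2 guess the loss [w 1 - w 2], 3 and 4 are the
   guessed addable jobs. *)
Definition loss : realexp := Minus (WeightOf 1) (WeightOf 2).

Definition guess_test : boolexp :=
  (Not (eq_nat (Level 3) (Level 4)) || eq_nat (Level 3) JobCount)
  && LeReal Zero (Plus loss (WeightOf 3)) && LeReal Zero (Plus loss (WeightOf 4)).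

Definition item_test (f e : nat) : boolexp :=
  lt_nat (Level f) JobCount && Member f
  && Not (eq_nat (Level f) (Level 3)) && Not (eq_nat (Level f) (Level 4))
  && disjoint f 3 && disjoint f 4
  && Not (eq_nat (Level e) (Level f)) && LeReal (WeightOf f) (Plus loss (WeightOf e))
  && (eq_nat (Level e) (Level 3) || nonempty f && nonempty e).

Definition link_test (f e f' e' : nat) : boolexp :=
  LeNat (EndOf f) (StartOf f) && (nonempty f' || lt_nat (Level f) (Level f'))
  || nonempty f && nonempty f' && LeNat (EndOf f) (StartOf f')
     && (eq_nat (Level e) (Level 3) || LeNat (EndOf e) (StartOf f'))
     && (eq_nat (Level e') (Level 3) || LeNat (EndOf f) (StartOf e')).

Definition init_table : cmd := For (For (SetTable 5 6 (WeightOf 5))).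

(** [(6, 7)] is the predecessor and [(8, 9)] the item being improved. The table is overwritten in
    place, so a round may advance along several links; entries only grow, hence no bound is lost. *)
Definition relax : cmd :=
  let x := Plus (Table 6 7) (WeightOf 8) in
  If (item_test 6 7 && item_test 8 9 && link_test 6 7 8 9 && LeReal (Table 8 9) x)
     (SetTable 8 9 x) Skip.

Definition relax_round : cmd := For (For (For (For relax))).

Definition improve (x : realexp) : cmd := If (LeReal (Scalar 0) x) (SetScalar 0 x) Skip.

(** The empty chain owns no table entry, which is why its value [0 - loss] is tried separately. *)
Definition try_guess : cmd :=
  If guess_test
    (init_table;; For relax_round;; improve (Minus Zero loss);;
     For (For (If (item_test 5 6) (improve (Minus (Table 5 6) loss)) Skip)))
    Skip.

Definition best_value : cmd := SetScalar 0 Zero;; For (For (For (For try_guess))).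

(** Scalar 1 keeps the value before the tentative removal. The last iteration tests the dummy [n],
    which [item_test] never admits to a chain, so this does no harm. *)
Definition algorithm : cmd :=
  For (SetMember 0 true);;
  For (best_value;; SetScalar 1 (Scalar 0);; SetMember 0 false;; best_value;;
       If (LeReal (Scalar 1) (Scalar 0)) Skip (SetMember 0 true)).

Local Close Scope cmd_scope.

(** * Correctness of the algorithm: relaxation, best value, elimination *)

Section Correctness.
Variables (n : nat) (a b : nat -> nat) (w : nat -> R).
Hypothesis dummy_empty : (b n <= a n)%nat.
Hypothesis dummy_weight : w n = 0.
Hypothesis w_nonneg : forall j, 0 <= w j.

Notation evalb := (eval_bool n a b w).
Notation runc := (run n a b w).

Lemma eval_and v s x y : evalb v s (And x y) = true <-> evalb v s x = true /\ evalb v s y = true.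
Proof. apply andb_true_iff. Qed.
Lemma eval_or v s x y : evalb v s (Or x y) = true <-> evalb v s x = true \/ evalb v s y = true.
Proof. apply orb_true_iff. Qed.
Lemma eval_not v s x : evalb v s (Not x) = true <-> ~ evalb v s x = true.
Proof. simpl. rewrite negb_true_iff, not_true_iff_false. reflexivity. Qed.
Lemma eval_le v s x y : evalb v s (LeNat x y) = true <-> (eval_nat n a b v x <= eval_nat n a b v y)%nat.
Proof. apply Nat.leb_le. Qed.
Lemma eval_lt v s x y : evalb v s (lt_nat x y) = true <-> (eval_nat n a b v x < eval_nat n a b v y)%nat.
Proof. unfold lt_nat. rewrite eval_not, eval_le. lia. Qed.
Lemma eval_eq v s x y : evalb v s (eq_nat x y) = true <-> (eval_nat n a b v x = eval_nat n a b v y)%nat.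
Proof. unfold eq_nat. rewrite eval_and, !eval_le. lia. Qed.
Lemma eval_le_real v s x y : evalb v s (LeReal x y) = true <-> eval_real w v s x <= eval_real w v s y.
Proof. apply Rleb_iff. Qed.
Lemma eval_disjoint v s k l : evalb v s (disjoint k l) = disjb a b (v k) (v l).
Proof. reflexivity. Qed.

Definition guess_loss (v : nat -> nat) : R := w (v 1%nat) - w (v 2%nat).
Notation itemok v X := (item_ok n a b w X (guess_loss v) (v 3%nat) (v 4%nat))
  (v in scope function_scope).
Notation chainok v X := (chain n a b w X (guess_loss v) (v 3%nat) (v 4%nat))
  (v in scope function_scope).

Lemma guess_test_iff v s : (v 3 <= n)%nat -> (v 4 <= n)%nat ->
  evalb v s guess_test = true <-> guess_ok n w (guess_loss v) (v 3%nat) (v 4%nat).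
Proof.
  intros H3 H4. unfold guess_test, guess_ok.
  rewrite !eval_and, eval_or, eval_not, !eval_eq, !eval_le_real. simpl. unfold guess_loss. tauto.
Qed.

Lemma item_test_iff v s f e : (v e <= n)%nat ->
  evalb v s (item_test f e) = true <-> itemok v (members s) (v f, v e).
Proof.
  intros He. unfold item_test, item_ok, nonempty.
  rewrite !eval_and, !eval_or, !eval_not, !eval_and, !eval_lt, !eval_eq, !eval_le_real,
    !eval_disjoint. simpl. unfold guess_loss. tauto.
Qed.

Lemma link_test_iff v s f e f' e' :
  evalb v s (link_test f e f' e') = true <-> link a b (v 3%nat) (v f, v e) (v f', v e').
Proof.
  unfold link_test, link, nonempty.
  rewrite !eval_or, !eval_and, !eval_or, !eval_lt, !eval_eq, !eval_le. simpl. tauto.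
Qed.

Definition table_le (s s' : store) : Prop := forall i j, table s i j <= table s' i j.

(** Entries of pairs violating [item_ok] are left unconstrained: the item tests guard every use of
    an entry. *)
Definition table_sound (v : nat -> nat) (s : store) : Prop :=
  forall f e, itemok v (members s) (f, e) ->
    exists L, chainok v (members s) ((f, e) :: L) /\ table s f e <= chain_weight w ((f, e) :: L).

Definition relax_inv (v : nat -> nat) (s0 s : store) : Prop :=
  members s = members s0 /\ scalars s = scalars s0 /\ table_le s0 s /\ table_sound v s.

Lemma relax_inv_guess v v' s0 s :
  (forall k, (k < 5)%nat -> v k = v' k) -> relax_inv v s0 s -> relax_inv v' s0 s.
Proof.
  intros E. unfold relax_inv, table_sound, guess_loss.
  rewrite !E by lia. tauto.
Qed.

Lemma relax_spec v s0 s : (v 7 <= n)%nat -> (v 9 <= n)%nat -> relax_inv v s0 s ->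
  relax_inv v s0 (runc 10 relax v s) /\
  (itemok v (members s) (v 6, v 7)%nat -> itemok v (members s) (v 8, v 9)%nat ->
   link a b (v 3%nat) (v 6, v 7)%nat (v 8, v 9)%nat ->
   table s (v 6%nat) (v 7%nat) + w (v 8%nat) <= table (runc 10 relax v s) (v 8%nat) (v 9%nat)).
Proof.
  intros H7 H9 (EM & ES & TL & TS). unfold relax. cbn [run].
  match goal with |- context [eval_bool n a b w v s ?x] => destruct (evalb v s x) eqn:E end.
  - rewrite !eval_and, !item_test_iff, link_test_iff, eval_le_real in E by assumption.
    destruct E as (((O & O') & K) & LE). cbn [eval_real] in LE |- *.
    split; [|intros _ _ _; cbn [table]; unfold upd; rewrite !Nat.eqb_refl; lra].
    split; [assumption|]. split; [assumption|]. split.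
    + intros i j. specialize (TL i j). cbn [table]. unfold upd.
      destruct (Nat.eqb_spec i (v 8%nat)) as [->|]; [|assumption].
      destruct (Nat.eqb_spec j (v 9%nat)) as [->|]; [lra|assumption].
    + intros f e Hfe. cbn [table members] in *. unfold upd.
      destruct (TS f e Hfe) as (L & C & H).
      destruct (Nat.eqb_spec f (v 8%nat)) as [->|]; [|now exists L].
      destruct (Nat.eqb_spec e (v 9%nat)) as [->|]; [|now exists L].
      destruct (TS _ _ O) as (L' & C' & H'). exists ((v 6, v 7)%nat :: L'). split.
      * now apply chain_extend.
      * simpl in *. lra.
  - split; [repeat split; assumption|]. intros O O' K. apply Rnot_lt_le. intros LT.
    apply not_true_iff_false in E. apply E.
    rewrite !eval_and, !item_test_iff, link_test_iff, eval_le_real by assumption.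
    split; [tauto|]. cbn [eval_real]. cbn [run] in LT. lra.
Qed.

Lemma relax_round_spec v s : table_sound v s ->
  relax_inv v s (runc 6 relax_round v s) /\
  forall f e f' e', (f <= n)%nat -> (e <= n)%nat -> (f' <= n)%nat -> (e' <= n)%nat ->
    itemok v (members s) (f, e) -> itemok v (members s) (f', e') ->
    link a b (v 3%nat) (f, e) (f', e') ->
    table s f e + w f' <= table (runc 6 relax_round v s) f' e'.
Proof.
  intros TS.
  assert (I0 : relax_inv v s s) by (repeat split; auto; intros i j; lra).
  (* Naming the innermost command as a function of its four indices lets the nested loops be peeled
     off one at a time. *)
  set (body f e f' e' :=
         runc 10 relax (upd (upd (upd (upd v 6 f) 7 e) 8 f') 9 e')%nat).
  assert (B : forall f e f' e' t, (e < S n)%nat -> (e' < S n)%nat ->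
     relax_inv v s t -> relax_inv v s (body f e f' e' t) /\ table_le t (body f e f' e' t) /\
     (itemok v (members s) (f, e) -> itemok v (members s) (f', e') ->
      link a b (v 3%nat) (f, e) (f', e') -> table s f e + w f' <= table (body f e f' e' t) f' e')).
  { intros f e f' e' t He He' It. unfold body.
    set (v' := upd (upd (upd (upd v 6 f) 7 e) 8 f') 9 e').
    assert (EV : forall k, (k < 5)%nat -> v k = v' k).
    { intros k Hk. unfold v', upd. rewrite !(proj2 (Nat.eqb_neq k _)) by lia. reflexivity. }
    assert (It' : relax_inv v' t t).
    { apply (relax_inv_guess v); [assumption|]. destruct It as (? & ? & ? & ?).
      repeat split; auto. intros i j; lra. }
    destruct (relax_spec v' t t) as [(M1 & M2 & M3 & M4) R];
      [unfold v', upd; simpl; lia..|assumption|].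
    destruct It as (E1 & E2 & E3 & E4).
    split; [|split; [assumption|]].
    - apply (relax_inv_guess v' v); [intros; symmetry; auto|].
      split; [congruence|]. split; [congruence|]. split; [|assumption].
      intros i j. eapply Rle_trans; [apply E3|apply M3].
    - intros O O' K. specialize (E3 f e). rewrite E1 in R.
      change (v' 6%nat) with f in R. change (v' 7%nat) with e in R.
      change (v' 8%nat) with f' in R. change (v' 9%nat) with e' in R.
      unfold guess_loss in R. rewrite <- !EV in R by lia. specialize (R O O' K). lra. }
  assert (RE : runc 6 relax_round v s =
     loop (S n) (fun f => loop (S n) (fun e => loop (S n) (fun f' => loop (S n)
       (fun e' => body f e f' e')))) s) by reflexivity.
  rewrite RE. clear RE. split.
  - do 4 (apply loop_const_inv; [assumption|intros]). now apply B.
  - intros f e f' e' Hf He Hf' He' O O' K.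
    set (Q t := table s f e + w f' <= table t f' e').
    assert (BQ : forall f e f' e' t, (e < S n)%nat -> (e' < S n)%nat ->
      relax_inv v s t /\ Q t -> relax_inv v s (body f e f' e' t) /\ Q (body f e f' e' t)).
    { intros f1 e2 f2 e3 t H1 H2 [It Qt]. destruct (B f1 e2 f2 e3 t H1 H2 It) as (J1 & J2 & _).
      split; [assumption|]. unfold Q. eapply Rle_trans; [exact Qt|apply J2]. }
    apply (loop_reach (relax_inv v s) Q _ _ _ f); [lia|assumption| | |].
    { intros. do 3 (apply loop_const_inv; [assumption|intros]). now apply B. }
    { intros. do 3 (apply (loop_const_inv (fun t => relax_inv v s t /\ Q t)); [assumption|intros]).
      now apply BQ. }
    intros. apply (loop_reach (relax_inv v s) Q _ _ _ e); [lia|assumption| | |].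
    { intros. do 2 (apply loop_const_inv; [assumption|intros]). now apply B. }
    { intros. do 2 (apply (loop_const_inv (fun t => relax_inv v s t /\ Q t)); [assumption|intros]).
      now apply BQ. }
    intros. apply (loop_reach (relax_inv v s) Q _ _ _ f'); [lia|assumption| | |].
    { intros. apply loop_const_inv; [assumption|intros]. apply B; auto. lia. }
    { intros. apply (loop_const_inv (fun t => relax_inv v s t /\ Q t)); [assumption|intros].
      apply BQ; auto. lia. }
    intros. apply (loop_reach (relax_inv v s) Q _ _ _ e'); [lia|assumption| | |].
    { intros. apply B; auto. lia. }
    { intros. apply BQ; auto. lia. }
    intros x Ix. destruct (B f e f' e' x ltac:(lia) ltac:(lia) Ix) as (J1 & _ & J3).
    split; [assumption|]. now apply J3.
Qed.

Lemma init_table_spec v s :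
  members (runc 5 init_table v s) = members s /\
  scalars (runc 5 init_table v s) = scalars s /\
  forall f e, (f <= n)%nat -> (e <= n)%nat -> table (runc 5 init_table v s) f e = w f.
Proof.
  set (I t := members t = members s /\ scalars t = scalars s).
  assert (R : forall f e, (f <= n)%nat -> (e <= n)%nat ->
    I (runc 5 init_table v s) /\ table (runc 5 init_table v s) f e = w f).
  { intros f e Hf He. unfold init_table. cbn [run].
    set (Q t := table t f e = w f).
    apply (loop_reach I Q _ _ _ f); [lia|split; reflexivity| | |].
    { intros i t Hi It. now apply loop_const_inv. }
    { intros i t Hi It. apply (loop_const_inv (fun t => I t /\ Q t)); [assumption|].
      intros i' t' Hi' [It' Qt']. split; [assumption|]. unfold Q in *. cbn. unfold upd. cbn.
      destruct (Nat.eqb_spec f i) as [->|]; [|assumption].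
      destruct (Nat.eqb_spec e i') as [->|]; [reflexivity|assumption]. }
    intros t It. apply (loop_reach I Q _ _ _ e); [lia|assumption| | |].
    { intros i' t' Hi' It'. assumption. }
    { intros i' t' Hi' [It' Qt']. split; [assumption|]. unfold Q in *. cbn. unfold upd. cbn.
      rewrite Nat.eqb_refl. destruct (Nat.eqb_spec e i') as [->|]; [reflexivity|assumption]. }
    intros t' It'. split; [assumption|]. unfold Q. cbn. unfold upd. cbn.
    now rewrite !Nat.eqb_refl. }
  destruct (R 0 0)%nat as [[E1 E2] _]; [lia..|]. repeat split; auto. intros. now apply R.
Qed.

(** The Bellman-Ford invariant after [r] rounds; [r] bounds the number of items before the last
    one. *)
Definition table_complete (v : nat -> nat) (r : nat) (s : store) : Prop :=
  forall f e L, chainok v (members s) ((f, e) :: L) -> (length L <= r)%nat ->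
    chain_weight w ((f, e) :: L) <= table s f e.

Lemma table_spec v s : let s' := runc 5 (Seq init_table (For relax_round)) v s in
  members s' = members s /\ scalars s' = scalars s /\ table_sound v s' /\
  forall f e L, chainok v (members s) ((f, e) :: L) -> chain_weight w ((f, e) :: L) <= table s' f e.
Proof.
  cbn [run]. destruct (init_table_spec v s) as (E1 & E2 & E3).
  set (t := runc 5 init_table v s) in *. clearbody t.
  assert (H : let s' := loop (S n) (fun i s => runc 6 relax_round (upd v 5 i)%nat s) t in
     (members s' = members s /\ scalars s' = scalars s /\ table_sound v s') /\
     table_complete v (S n) s').
  { cbv zeta. apply (loop_inv (fun r s' =>
      (members s' = members s /\ scalars s' = scalars s /\ table_sound v s') /\
       table_complete v r s')).
    - split; [split; [assumption|]; split; [assumption|]|].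
      + intros f e O. exists []. split; [constructor; [assumption|constructor..]|].
        cbn [chain_weight fold_right fst].
        cbn in O. rewrite E3 by lia. lra.
      + intros f e L C HL. destruct L; [|simpl in HL; lia]. apply chain_items_ok in C.
        inversion C as [|? ? O]; subst. simpl in O |- *. rewrite E3 by lia. lra.
    - intros r u Hr [(U1 & U2 & U3) U4]. set (v' := upd v 5%nat r).
      destruct (relax_round_spec v' u) as [(R1 & R2 & R3 & R4) R5]; [exact U3|].
      split; [split; [congruence|]; split; [congruence|exact R4]|].
      intros f e L C HL. rewrite R1 in C.
      (* Only chains with exactly [r + 1] predecessors need the present round, for their final link;
         shorter ones are covered because the table never decreases. *)
      destruct (Nat.eq_dec (length L) (S r)) as [EL|NL].
      + destruct L as [|[f1 e1] L]; [discriminate|].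
        inversion C as [|? ? O F C']; subst. inversion F as [|? ? K F']; subst.
        assert (O' := chain_items_ok _ _ _ _ _ _ _ _ _ C').
        inversion O' as [|? ? O1 O2]; subst. clear O' O2.
        assert (Hw := U4 f1 e1 L C' ltac:(simpl in EL; lia)).
        assert (HR := R5 f1 e1 f e). simpl in O, O1.
        specialize (HR ltac:(lia) ltac:(lia) ltac:(lia) ltac:(lia) O1 O K).
        unfold chain_weight in *. cbn [fold_right fst] in Hw |- *. eapply Rle_trans; [|exact HR]. lra.
      + eapply Rle_trans; [apply (U4 f e L C)|apply R3]. lia. }
  cbv zeta in H. destruct H as [(H1 & H2 & H3) H4].
  split; [assumption|]. split; [assumption|]. split; [assumption|]. intros f e L C. apply H4.
  - now rewrite H1.
  - apply chain_length in C. simpl in C. lia.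
Qed.

Definition value_sound (s : store) : Prop :=
  exists S, feasible n a b S /\ (forall j, (j < n)%nat -> S j = true -> members s j = true) /\
    scalars s 0%nat <= robust_value n a b w S.

Definition value_inv (s0 s : store) : Prop :=
  members s = members s0 /\ scalars s 1%nat = scalars s0 1%nat /\
  scalars s0 0%nat <= scalars s 0%nat /\ value_sound s.

Lemma value_inv_trans s0 s1 s2 : value_inv s0 s1 -> value_inv s1 s2 -> value_inv s0 s2.
Proof.
  intros (A1 & A2 & A3 & A4) (B1 & B2 & B3 & B4).
  split; [congruence|]. split; [congruence|]. split; [lra|assumption].
Qed.

Lemma improve_spec d v s x :
  let s' := runc d (improve x) v s in
  table s' = table s /\ members s' = members s /\ scalars s' 1%nat = scalars s 1%nat /\
  (scalars s' 0%nat = scalars s 0%nat \/ scalars s' 0%nat = eval_real w v s x) /\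
  scalars s 0%nat <= scalars s' 0%nat /\ eval_real w v s x <= scalars s' 0%nat.
Proof.
  unfold improve. cbn [run].
  match goal with |- context [eval_bool n a b w v s ?x] => destruct (evalb v s x) eqn:E end.
  - rewrite eval_le_real in E. cbn in *. repeat split; auto; lra.
  - apply not_true_iff_false in E. rewrite eval_le_real in E. cbn in *.
    repeat split; auto; lra.
Qed.

Lemma improve_sound d v s x :
  (scalars s 0%nat <= eval_real w v s x -> exists S, feasible n a b S /\
     (forall j, (j < n)%nat -> S j = true -> members s j = true) /\
     eval_real w v s x <= robust_value n a b w S) ->
  value_sound s -> value_inv s (runc d (improve x) v s).
Proof.
  intros H HS. destruct (improve_spec d v s x) as (E1 & E2 & E3 & E4 & E5 & E6).
  split; [assumption|]. split; [assumption|]. split; [assumption|].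
  unfold value_sound. rewrite E2. destruct E4 as [->|E4]; [assumption|].
  rewrite E4 in *. apply H. assumption.
Qed.

Lemma try_guess_spec v s : (v 3 <= n)%nat -> (v 4 <= n)%nat -> value_sound s ->
  value_inv s (runc 5 try_guess v s) /\
  (guess_ok n w (guess_loss v) (v 3%nat) (v 4%nat) -> forall L, chainok v (members s) L ->
    chain_weight w L - guess_loss v <= scalars (runc 5 try_guess v s) 0%nat).
Proof.
  intros H3 H4 VS.
  assert (VR : value_inv s s) by (repeat split; auto; lra).
  unfold try_guess. cbn [run]. destruct (evalb v s guess_test) eqn:G.
  2:{ split; [assumption|]. intros G'. apply not_true_iff_false in G. exfalso. apply G.
      now apply guess_test_iff. }
  apply guess_test_iff in G; [|assumption..].
  destruct (table_spec v s) as (T1 & T2 & T3 & T4). cbn [run] in T1, T2, T3, T4.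
  set (t := loop (S n) (fun i s0 => runc 6 relax_round (upd v 5%nat i) s0)
              (runc 5 init_table v s)) in *. clearbody t.
  assert (Vt : value_inv s t).
  { split; [assumption|]. rewrite T2. split; [reflexivity|]. split; [lra|].
    unfold value_sound. now rewrite T1, T2. }
  destruct (improve_spec 5 v t (Minus Zero loss)) as (E1 & E2 & E3 & _ & E5 & E6).
  assert (Vu : value_inv s (runc 5 (improve (Minus Zero loss)) v t)).
  { apply (value_inv_trans _ t); [assumption|]. apply improve_sound; [|apply Vt]. intros _.
    destruct (chain_sound n a b w dummy_empty dummy_weight (members t) (guess_loss v) (v 3%nat)
       (v 4%nat) []) as (S & FS & SS & RS); [assumption|constructor|].
    exists S. repeat split; try assumption. }
  set (u := runc 5 (improve (Minus Zero loss)) v t) in *. clearbody u.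
  set (body i j t := if evalb (upd (upd v 5 i) 6 j)%nat t (item_test 5 6)
       then runc 7 (improve (Minus (Table 5 6) loss)) (upd (upd v 5 i) 6 j)%nat t else t).
  set (I x := value_inv s x /\ table x = table t /\ scalars u 0%nat <= scalars x 0%nat).
  assert (B : forall i j x, (j < S n)%nat -> I x -> I (body i j x) /\
     scalars x 0%nat <= scalars (body i j x) 0%nat /\
     (itemok v (members s) (i, j) -> table t i j - guess_loss v <= scalars (body i j x) 0%nat)).
  { intros i j x Hj (X1 & X2 & X3). unfold body.
    assert (IT := item_test_iff (upd (upd v 5 i) 6 j)%nat x 5 6 ltac:(unfold upd; simpl; lia)).
    change (itemok (upd (upd v 5 i) 6 j)%nat (members x)
              (upd (upd v 5 i) 6 j 5, upd (upd v 5 i) 6 j 6)%nat)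
      with (itemok v (members x) (i, j)) in IT. rewrite (proj1 X1) in IT.
    destruct (evalb (upd (upd v 5 i) 6 j)%nat x (item_test 5 6)).
    2:{ split; [split; auto|]. split; [lra|]. intros O. apply IT in O. discriminate. }
    destruct IT as [O _]. specialize (O eq_refl).
    destruct (improve_spec 7 (upd (upd v 5 i) 6 j)%nat x (Minus (Table 5 6) loss))
      as (P1 & P2 & P3 & _ & P5 & P6).
    assert (EV : eval_real w (upd (upd v 5 i) 6 j)%nat x (Minus (Table 5 6) loss) =
                   table t i j - guess_loss v) by (rewrite <- X2; reflexivity).
    split; [split; [|split; [congruence|lra]]|].
    - apply (value_inv_trans _ x); [assumption|]. apply improve_sound; [|apply X1]. intros _.
      rewrite EV, (proj1 X1). rewrite <- T1 in O. destruct (T3 i j O) as (L & C & HL).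
      destruct (chain_sound n a b w dummy_empty dummy_weight _ _ _ _ _ G C) as (S & FS & SS & RS).
      rewrite T1 in SS. exists S. repeat split; try assumption. lra.
    - split; [lra|]. intros _. rewrite <- EV. exact P6. }
  change (loop (S n) (fun i s0 => loop (S n) _ s0) u) with
    (loop (S n) (fun i => loop (S n) (fun j => body i j)) u).
  assert (Iu : I u) by (split; [assumption|split; [assumption|lra]]).
  assert (IL : I (loop (S n) (fun i => loop (S n) (fun j => body i j)) u)).
  { do 2 (apply loop_const_inv; [assumption|intros]). now apply B. }
  split; [apply IL|]. intros _ L C. destruct L as [|[f e] L].
  - destruct IL as (_ & _ & IL). simpl in E6 |- *. unfold guess_loss in *.
    eapply Rle_trans; [|exact IL]. lra.
  - assert (O := chain_items_ok _ _ _ _ _ _ _ _ _ C). inversion O as [|? ? O1 _]; subst. clear O.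
    set (Q x := table t f e - guess_loss v <= scalars x 0%nat).
    enough (I (loop (S n) (fun i => loop (S n) (fun j => body i j)) u) /\
            Q (loop (S n) (fun i => loop (S n) (fun j => body i j)) u)) as [_ H].
    { specialize (T4 f e L C). unfold Q in H. lra. }
    assert (BQ : forall i j x, (j < S n)%nat -> I x /\ Q x -> I (body i j x) /\ Q (body i j x)).
    { intros i j x Hj [Ix Qx]. destruct (B i j x Hj Ix) as (P1 & P2 & _).
      split; [assumption|]. unfold Q in *. lra. }
    assert (O2 := O1). simpl in O2.
    apply (loop_reach I Q _ _ _ f); [lia|assumption| | |].
    { intros. apply loop_const_inv; [assumption|intros]. now apply B. }
    { intros. apply (loop_const_inv (fun t => I t /\ Q t)); [assumption|intros]. now apply BQ. }
    intros. apply (loop_reach I Q _ _ _ e); [lia|assumption| | |].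
    { intros. now apply B. }
    { intros. now apply BQ. }
    intros x Ix. destruct (B f e x ltac:(lia) Ix) as (P1 & _ & P3). split; [assumption|].
    now apply P3.
Qed.

(** Scalar 0 ends up as the maximal robust value within [members s]: [chain_sound] backs each value
    found by an actual solution, and [chain_complete] names a guess and a chain that reach any given
    solution. *)
Lemma best_value_spec v s : let s' := runc 1 best_value v s in
  members s' = members s /\ scalars s' 1%nat = scalars s 1%nat /\ value_sound s' /\
  forall S, feasible n a b S -> (forall j, (j < n)%nat -> S j = true -> members s j = true) ->
    robust_value n a b w S <= scalars s' 0%nat.
Proof.
  unfold best_value. cbn [run].
  set (t := mkStore (members s) (table s) (upd (scalars s) 0%nat (eval_real w v s Zero))).
  assert (It : value_inv t t).
  { repeat split; auto; [lra|].
    (* The starting value 0 is certified by the empty chain with loss 0 and the dummy as both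
       addable jobs. *)
    destruct (chain_sound n a b w dummy_empty dummy_weight (members s) 0 n n [])
      as (S & FS & SS & RS); [|constructor|].
    - repeat split; auto; rewrite dummy_weight; lra.
    - exists S. repeat split; try assumption. simpl in *. unfold upd. simpl. lra. }
  set (body f0 e0 e1 e2 :=
         runc 5 try_guess (upd (upd (upd (upd v 1 f0) 2 e0) 3 e1) 4 e2)%nat).
  assert (B : forall f0 e0 e1 e2 x, (e1 < S n)%nat -> (e2 < S n)%nat -> value_inv t x ->
    value_inv t (body f0 e0 e1 e2 x) /\ scalars x 0%nat <= scalars (body f0 e0 e1 e2 x) 0%nat /\
    (guess_ok n w (w f0 - w e0) e1 e2 -> forall L,
      chain n a b w (members s) (w f0 - w e0) e1 e2 L ->
      chain_weight w L - (w f0 - w e0) <= scalars (body f0 e0 e1 e2 x) 0%nat)).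
  { intros f0 e0 e1 e2 x He1 He2 Ix.
    destruct (try_guess_spec (upd (upd (upd (upd v 1 f0) 2 e0) 3 e1) 4 e2)%nat x)
      as [V1 V2]; [unfold upd; simpl; lia..|apply Ix|].
    split; [eapply value_inv_trans; [exact Ix|exact V1]|]. split; [apply V1|].
    rewrite (proj1 Ix) in V2. exact V2. }
  change (loop (S n) (fun i s0 => loop (S n) _ s0) t) with
    (loop (S n) (fun f0 => loop (S n) (fun e0 => loop (S n) (fun e1 => loop (S n)
       (fun e2 => body f0 e0 e1 e2)))) t).
  set (res := loop _ _ t).
  assert (IR : value_inv t res).
  { unfold res. do 4 (apply loop_const_inv; [assumption|intros]). now apply B. }
  split; [apply IR|]. split; [apply IR|]. split; [apply IR|].
  intros U FU UX.
  destruct (chain_complete n a b w dummy_empty dummy_weight w_nonneg (members s) U FU UX)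
    as (f0 & e0 & e1 & e2 & L & Hf0 & He0 & G & C & ->).
  assert (G' := G). destruct G' as (He1 & He2 & _).
  set (I := value_inv t). set (Q x := chain_weight w L - (w f0 - w e0) <= scalars x 0%nat).
  enough (I res /\ Q res) as [_ H] by exact H.
  assert (BQ : forall f0 e0 e1 e2 x, (e1 < S n)%nat -> (e2 < S n)%nat -> I x /\ Q x ->
    I (body f0 e0 e1 e2 x) /\ Q (body f0 e0 e1 e2 x)).
  { intros g0 h0 g1 g2 x H1 H2 [Ix Qx]. destruct (B g0 h0 g1 g2 x H1 H2 Ix) as (P1 & P2 & _).
    split; [assumption|]. unfold Q in *. lra. }
  unfold res. apply (loop_reach I Q _ _ _ f0); [lia|assumption| | |].
  { intros. do 3 (apply loop_const_inv; [assumption|intros]). now apply B. }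
  { intros. do 3 (apply (loop_const_inv (fun t => I t /\ Q t)); [assumption|intros]).
    now apply BQ. }
  intros. apply (loop_reach I Q _ _ _ e0); [lia|assumption| | |].
  { intros. do 2 (apply loop_const_inv; [assumption|intros]). now apply B. }
  { intros. do 2 (apply (loop_const_inv (fun t => I t /\ Q t)); [assumption|intros]).
    now apply BQ. }
  intros. apply (loop_reach I Q _ _ _ e1); [lia|assumption| | |].
  { intros. apply loop_const_inv; [assumption|intros]. now apply B. }
  { intros. apply (loop_const_inv (fun t => I t /\ Q t)); [assumption|intros]. now apply BQ. }
  intros. apply (loop_reach I Q _ _ _ e2); [lia|assumption| | |].
  { intros. apply B; auto. lia. }
  { intros. apply BQ; auto. lia. }
  intros x Ix. destruct (B f0 e0 e1 e2 x ltac:(lia) ltac:(lia) Ix) as (P1 & _ & P3).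
  split; [assumption|]. now apply P3.
Qed.

Definition optimal_within (X : nat -> bool) (U : nat -> bool) : Prop :=
  optimal_robust n a b w U /\ forall j, (j < n)%nat -> U j = true -> X j = true.

Lemma best_value_optimal v s U : optimal_within (members s) U ->
  scalars (runc 1 best_value v s) 0%nat = robust_value n a b w U.
Proof.
  intros [[FU HU] UX]. destruct (best_value_spec v s) as (_ & _ & (T & FT & _ & HT) & H).
  specialize (H U FU UX). specialize (HU T FT). lra.
Qed.

(** The third clause turns values into a solution: at the end every remaining job lies in every
    optimal solution inside the remaining set, so the set equals such a solution. It survives later
    removals, since a smaller set contains fewer optimal solutions. *)
Definition elimination_inv (j : nat) (s : store) : Prop :=
  (forall i, (j <= i)%nat -> (i <= n)%nat -> members s i = true) /\
  (exists U, optimal_within (members s) U) /\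
  forall i, (i < j)%nat -> (i < n)%nat -> members s i = true ->
    forall U, optimal_within (members s) U -> U i = true.

Lemma elimination_step v j s : (j <= n)%nat -> elimination_inv j s ->
  elimination_inv (S j)
    (runc 1 (Seq best_value (Seq (SetScalar 1 (Scalar 0)) (Seq (SetMember 0 false)
       (Seq best_value (If (LeReal (Scalar 1) (Scalar 0)) Skip (SetMember 0 true))))))
       (upd v 0%nat j) s).
Proof.
  intros Hj (A1 & (U & OU) & A3). set (v' := upd v 0%nat j). cbn [run].
  assert (E0 := best_value_optimal v' s U OU).
  destruct (best_value_spec v' s) as (B1 & _ & _ & _).
  set (s1 := runc 1 best_value v' s) in *. clearbody s1.
  set (s2 := mkStore _ _ _).
  assert (M2 : members s2 = upd (members s) j false) by (cbn; now rewrite B1).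
  assert (K2 : scalars s2 1%nat = robust_value n a b w U) by exact E0.
  destruct (best_value_spec v' s2) as (C1 & C2 & (T & FT & TX & HT) & C4).
  set (s3 := runc 1 best_value v' s2) in *. clearbody s3. rewrite M2 in C1, C4. rewrite C1 in TX.
  assert (SUB : forall V i, upd (members s) j V i = true -> i <> j -> members s i = true).
  { intros V i. unfold upd. destruct (Nat.eqb_spec i j); tauto. }
  assert (MJ : members s j = true) by (apply A1; lia).
  destruct OU as [[FU HU] UX].
  match goal with |- context [eval_bool n a b w v' s3 ?x] => destruct (evalb v' s3 x) eqn:E end.
  - rewrite eval_le_real in E. cbn [eval_real] in E. rewrite C2, K2 in E.
    split; [|split].
    + intros i Hi Hi'. rewrite C1. unfold upd. destruct (Nat.eqb_spec i j); [lia|apply A1; lia].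
    + exists T. rewrite C1. split; [split; [assumption|]|assumption].
      intros T' FT'. specialize (HU T' FT'). lra.
    + rewrite C1. intros i Hi Hin Mi V [OV VX]. destruct (Nat.eq_dec i j) as [->|Hij].
      * unfold upd in Mi. rewrite Nat.eqb_refl in Mi. discriminate.
      * apply A3; [lia|lia|eapply SUB; eassumption|]. split; [assumption|].
        intros k Hk Vk. specialize (VX k Hk Vk). unfold upd in VX.
        destruct (Nat.eqb_spec k j); [discriminate|assumption].
  - apply not_true_iff_false in E. rewrite eval_le_real in E. cbn [eval_real] in E.
    rewrite C2, K2 in E.
    assert (ME : forall i, members (mkStore (upd (members s3) (v' 0%nat) true) (table s3)
        (scalars s3)) i = members s i).
    { intros i. cbn [members]. rewrite C1. unfold v', upd. simpl.
      destruct (Nat.eqb_spec i j); congruence. }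
    assert (OE : forall V, optimal_within (members (mkStore (upd (members s3) (v' 0%nat) true)
        (table s3) (scalars s3))) V <-> optimal_within (members s) V).
    { intros V. unfold optimal_within. split; intros [OV VX]; (split; [assumption|]);
        intros k Hk Vk; specialize (VX k Hk Vk); [rewrite <- ME|rewrite ME]; assumption. }
    split; [|split].
    + intros i Hi Hi'. rewrite ME. apply A1; lia.
    + exists U. apply OE. now repeat split.
    + intros i Hi Hin Mi V OV. rewrite ME in Mi. apply OE in OV.
      destruct (Nat.eq_dec i j) as [->|Hij]; [|apply A3; lia || assumption].
      (* An optimal solution avoiding [j] would fit into the set without [j], and the value would
         not have dropped. *)
      destruct (V j) eqn:Vj; [reflexivity|]. exfalso. apply E.
      destruct OV as [[FV HV] VX]. specialize (HV U FU).
      eapply Rle_trans; [exact HV|]. apply C4; [assumption|].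
      intros k Hk Vk. unfold upd. destruct (Nat.eqb_spec k j); [congruence|auto].
Qed.

Theorem algorithm_correct v s : optimal_robust n a b w (members (runc 0 algorithm v s)).
Proof.
  unfold algorithm. cbn [run].
  set (t := loop (S n) _ s).
  assert (T : forall i, (i <= n)%nat -> members t i = true).
  { intros i Hi.
    enough (True /\ members t i = true) by tauto.
    apply (loop_reach (fun _ => True) (fun t => members t i = true) _ _ _ i);
      [lia|tauto|tauto| |].
    - intros k u _ [_ H]. split; [trivial|]. cbn. unfold upd at 1. cbn.
      destruct (i =? k)%nat; [reflexivity|assumption].
    - intros u _. split; [trivial|]. cbn. unfold upd at 1. cbn. now rewrite Nat.eqb_refl. }
  assert (I0 : elimination_inv 0 t).
  { split; [auto|]. split; [|lia].
    destruct (best_value_spec v t) as (B1 & _ & (U & FU & UX & HU) & B4).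
    exists U. split; [split; [assumption|]|intros j Hj _; apply T; lia].
    intros V FV. eapply Rle_trans; [|exact HU]. apply B4; [assumption|].
    intros j Hj _. apply T. lia. }
  match goal with |- context [loop (S n) ?f t] => set (body := f) end.
  assert (IN : elimination_inv (S n) (loop (S n) body t)).
  { apply (loop_inv elimination_inv); [assumption|]. intros j u Hj Iu.
    apply (elimination_step v j u); [lia|assumption]. }
  set (res := loop (S n) body t) in *. destruct IN as (_ & (U & OU) & H).
  assert (EQ : forall j, (j < n)%nat -> U j = members res j).
  { intros j Hj. destruct (members res j) eqn:E; [now apply (H j); [lia|..]|].
    destruct (U j) eqn:E'; [|reflexivity]. apply OU in E'; [congruence|assumption]. }
  destruct OU as [[FU HU] _]. split.
  - unfold feasible in *. rewrite <- FU. symmetry. now apply feasibleb_ext; auto.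
  - intros V FV. rewrite <- (robust_value_ext n a b a b w w U (members res)); auto.
Qed.
End Correctness.

(** * Compilation to the real-RAM *)

Open Scope nat_scope.

Lemma upd_same {A : Type} (m : nat -> A) i x : upd m i x i = x.
Proof. unfold upd. now rewrite Nat.eqb_refl. Qed.

Lemma upd_other {A : Type} (m : nat -> A) i x j : j <> i -> upd m i x j = m j.
Proof. intros H. unfold upd. now rewrite (proj2 (Nat.eqb_neq j i) H). Qed.

Ltac upd_simpl :=
  repeat match goal with
  | |- context [upd ?m ?i ?x ?j] => rewrite (upd_same m i x) || rewrite (upd_other m i x j) by lia
  end.

Lemma exec_add P t1 t2 s : exec P (t1 + t2) s = exec P t2 (exec P t1 s).
Proof. revert s. induction t1 as [|t1 IH]; intros s; simpl; auto. Qed.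

Definition code_at (P : program) (p : nat) (l : list instr) : Prop :=
  forall i x, nth_error l i = Some x -> nth_error P (p + i) = Some x.

Lemma code_at_app P p l1 l2 :
  code_at P p (l1 ++ l2) -> code_at P p l1 /\ code_at P (p + length l1) l2.
Proof.
  intros H. split; intros i x Hi.
  - apply H. rewrite nth_error_app1; [assumption|]. apply nth_error_Some. congruence.
  - rewrite <- Nat.add_assoc. apply H. rewrite nth_error_app2 by lia.
    now replace (length l1 + i - length l1) with i by lia.
Qed.

Lemma code_at_cons P p x l : code_at P p (x :: l) -> nth_error P p = Some x /\ code_at P (S p) l.
Proof.
  intros H. split.
  - rewrite <- (Nat.add_0_r p). now apply H.
  - intros i y Hi. replace (S p + i) with (p + S i) by lia. now apply H.
Qed.

Definition memory : Type := ((nat -> nat) * (nat -> R))%type.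

Definition effect (i : instr) (m : memory) : memory :=
  let (M, Rm) := m in
  match i with
  | NConst d c => (upd M d c, Rm)
  | NAdd d x y => (upd M d (M x + M y), Rm)
  | NSub d x y => (upd M d (M x - M y), Rm)
  | NLoad d x => (upd M d (M (M x)), Rm)
  | NStore x y => (upd M (M x) (M y), Rm)
  | RZero d => (M, upd Rm (M d) 0%R)
  | RAdd d x y => (M, upd Rm (M d) (Rm (M x) + Rm (M y))%R)
  | RSub d x y => (M, upd Rm (M d) (Rm (M x) - Rm (M y))%R)
  | RLe d x y => (upd M d (if Rle_dec (Rm (M x)) (Rm (M y)) then 1 else 0), Rm)
  | NJz _ _ | Halt => m
  end.

Definition straight (i : instr) : bool :=
  match i with NJz _ _ | Halt => false | _ => true end.

Fixpoint effects (l : list instr) (m : memory) : memory :=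
  match l with [] => m | i :: l => effects l (effect i m) end.

Lemma effects_app l1 l2 m : effects (l1 ++ l2) m = effects l2 (effects l1 m).
Proof. revert m. induction l1; simpl; auto. Qed.

Lemma exec_straight P p l M Rm : code_at P p l -> forallb straight l = true ->
  exec P (length l) (mkState p M Rm) =
  mkState (p + length l) (fst (effects l (M, Rm))) (snd (effects l (M, Rm))).
Proof.
  revert p M Rm. induction l as [|i l IH]; intros p M Rm C HS; simpl.
  - now rewrite Nat.add_0_r.
  - apply code_at_cons in C. destruct C as [Ci C]. simpl in HS.
    apply andb_true_iff in HS. destruct HS as [Hi HS].
    assert (E : step P (mkState p M Rm) =
      mkState (S p) (fst (effect i (M, Rm))) (snd (effect i (M, Rm)))).
    { unfold step. cbn [pc mem rmem]. rewrite Ci. destruct i; try discriminate; reflexivity. }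
    rewrite E, IH by assumption. rewrite <- surjective_pairing. f_equal. lia.
Qed.

Lemma exec_jump P p M Rm x l : nth_error P p = Some (NJz x l) ->
  exec P 1 (mkState p M Rm) = mkState (if M x =? 0 then l else S p) M Rm.
Proof. intros E. simpl. unfold step. cbn [pc mem rmem]. now rewrite E. Qed.

(* Registers: 0..3 hold n, 1, n+1, 0; 4..6 the bases of the arrays of starts, ends and members;
   7 the base of the real table; 8, 9 are scratch; 10..31 are boolean temporaries; a loop at
   depth k owns 32+3k (index), 33+3k (index times n+1, a row offset) and 34+3k (countdown).
   Real cells: 0..n are the weights, n+1.. the scalars, the first two of which belong to the
   source program while the others are temporaries. *)
Definition index (k : nat) : nat := 32 + 3 * k.
Definition row (k : nat) : nat := 33 + 3 * k.
Definition countdown (k : nat) : nat := 34 + 3 * k.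

(** Register 3 holds 0, so adding it is a move. Starts and ends stay interleaved as in the input,
    hence the doubled index. *)
Definition compile_nat (r : nat) (x : natexp) : list instr :=
  match x with
  | Level k => [NAdd r (index k) 3]
  | JobCount => [NAdd r 0 3]
  | StartOf k => [NAdd r (index k) (index k); NAdd r r 4; NLoad r r]
  | EndOf k => [NAdd r (index k) (index k); NAdd r r 5; NLoad r r]
  end.

Definition scalar_address (r t : nat) : list instr := [NConst r t; NAdd r r 2].
Definition table_address (r k l : nat) : list instr := [NAdd r (row k) (index l); NAdd r r 7].

(** There is no move between real cells: [RAdd] with register 0 as last operand adds cell [n], the
    weight 0 of the dummy job, and thereby copies. The result goes to temporary [t]. *)
Fixpoint compile_real (t : nat) (x : realexp) : list instr :=
  match x with
  | Zero => scalar_address 8 t ++ [RZero 8]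
  | WeightOf k => scalar_address 8 t ++ [RAdd 8 (index k) 0]
  | Table k l => scalar_address 8 t ++ table_address 9 k l ++ [RAdd 8 9 0]
  | Scalar c => scalar_address 8 t ++ scalar_address 9 c ++ [RAdd 8 9 0]
  | Plus x y => compile_real t x ++ compile_real (S t) y ++
      scalar_address 8 t ++ scalar_address 9 (S t) ++ [RAdd 8 8 9]
  | Minus x y => compile_real t x ++ compile_real (S t) y ++
      scalar_address 8 t ++ scalar_address 9 (S t) ++ [RSub 8 8 9]
  end.

(** With truth values 0 and 1 truncated subtraction does all the logic: [1 - x] negates, [x - y]
    vanishes exactly when [x <= y], [x + y - 1] is the conjunction, and negating [x + y] twice caps
    it at 1. *)
Fixpoint compile_bool (t : nat) (x : boolexp) : list instr :=
  match x with
  | LeNat x y => compile_nat 8 x ++ compile_nat 9 y ++ [NSub t 8 9; NSub t 1 t]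
  | LeReal x y => compile_real 2 x ++ compile_real 3 y ++
      scalar_address 8 2 ++ scalar_address 9 3 ++ [RLe t 8 9]
  | Member k => [NAdd t (index k) 6; NLoad t t]
  | Not x => compile_bool t x ++ [NSub t 1 t]
  | And x y => compile_bool t x ++ compile_bool (S t) y ++ [NAdd t t (S t); NSub t t 1]
  | Or x y => compile_bool t x ++ compile_bool (S t) y ++
      [NAdd t t (S t); NSub t 1 t; NSub t 1 t]
  end.

Definition straight_code (c : cmd) : list instr :=
  match c with
  | SetScalar c x => compile_real 2 x ++ scalar_address 8 c ++ scalar_address 9 2 ++ [RAdd 8 9 0]
  | SetTable k l x => compile_real 2 x ++ table_address 8 k l ++ scalar_address 9 2 ++ [RAdd 8 9 0]
  | SetMember k v => [NAdd 8 (index k) 6; NConst 9 (Nat.b2n v); NStore 8 9]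
  | _ => []
  end.

(** Independent of position and depth, so that [compile] can compute forward jump targets. *)
Fixpoint code_size (c : cmd) : nat :=
  match c with
  | Seq c1 c2 => code_size c1 + code_size c2
  | If x c1 c2 => length (compile_bool 10 x) + 2 + code_size c1 + code_size c2
  | For c => 8 + code_size c
  | _ => length (straight_code c)
  end.

(** [NJz 3] is the unconditional jump. The row offset is advanced by [n + 1] along with the index,
    because the machine cannot multiply. *)
Fixpoint compile (p d : nat) (c : cmd) : list instr :=
  match c with
  | Seq c1 c2 => compile p d c1 ++ compile (p + code_size c1) d c2
  | If x c1 c2 =>
      let q := p + length (compile_bool 10 x) in
      compile_bool 10 x ++ [NJz 10 (q + 2 + code_size c1)] ++ compile (q + 1) d c1 ++
      [NJz 3 (q + 2 + code_size c1 + code_size c2)] ++ compile (q + 2 + code_size c1) d c2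
  | For c =>
      [NConst (index d) 0; NConst (row d) 0; NAdd (countdown d) 2 3;
       NJz (countdown d) (p + 8 + code_size c)] ++ compile (p + 4) (S d) c ++
      [NAdd (index d) (index d) 1; NAdd (row d) (row d) 2;
       NSub (countdown d) (countdown d) 1; NJz 3 (p + 3)]
  | _ => straight_code c
  end.

Lemma compile_length c : forall p d, length (compile p d c) = code_size c.
Proof.
  induction c; intros p d; try reflexivity; cbn [compile code_size];
    repeat (rewrite length_app; cbn [length]); rewrite ?IHc, ?IHc1, ?IHc2; lia.
Qed.

Lemma compile_nat_straight r x : forallb straight (compile_nat r x) = true.
Proof. destruct x; reflexivity. Qed.

Lemma compile_real_straight x : forall t, forallb straight (compile_real t x) = true.
Proof.
  induction x; intros t; try reflexivity; cbn [compile_real];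
    rewrite !forallb_app, IHx1, IHx2; reflexivity.
Qed.

Lemma compile_bool_straight x : forall t, forallb straight (compile_bool t x) = true.
Proof.
  induction x; intros t; cbn [compile_bool];
    rewrite ?forallb_app, ?compile_nat_straight, ?compile_real_straight, ?IHx, ?IHx1, ?IHx2;
    reflexivity.
Qed.

Lemma straight_code_straight c : forallb straight (straight_code c) = true.
Proof.
  destruct c; try reflexivity; cbn [straight_code];
    rewrite ?forallb_app, ?compile_real_straight; reflexivity.
Qed.

Definition wf_nat (d : nat) (x : natexp) : bool :=
  match x with Level k | StartOf k | EndOf k => k <? d | JobCount => true end.

(** Sixteen cells from [n + 1] on are reserved for scalars and temporaries, so the table can start
    at [n + 17]. *)
Fixpoint wf_real (d t : nat) (x : realexp) : bool :=
  (t <? 16) &&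
  match x with
  | Zero => true
  | WeightOf k => k <? d
  | Table k l => (k <? d) && (l <? d)
  | Scalar c => c <? 2
  | Plus x y | Minus x y => wf_real d t x && wf_real d (S t) y
  end.

Fixpoint wf_bool (d t : nat) (x : boolexp) : bool :=
  (t <? 32) &&
  match x with
  | LeNat x y => wf_nat d x && wf_nat d y
  | LeReal x y => wf_real d 2 x && wf_real d 3 y
  | Member k => k <? d
  | Not x => wf_bool d t x
  | And x y | Or x y => wf_bool d t x && wf_bool d (S t) y
  end.

(** Loop depths below 32 keep all registers below [32 + 3 * 32 = 128], the least base of the
    arrays. *)
Fixpoint wf_cmd (d : nat) (c : cmd) : bool :=
  match c with
  | Skip => true
  | Seq c1 c2 => wf_cmd d c1 && wf_cmd d c2
  | If x c1 c2 => wf_bool d 10 x && wf_cmd d c1 && wf_cmd d c2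
  | For c => (d <? 32) && wf_cmd (S d) c
  | SetScalar c x => (c <? 2) && wf_real d 2 x
  | SetTable k l x => (k <? d) && (l <? d) && wf_real d 2 x
  | SetMember k _ => k <? d
  end.

Fixpoint time (n : nat) (c : cmd) : nat :=
  match c with
  | Seq c1 c2 => time n c1 + time n c2
  | If x c1 c2 => length (compile_bool 10 x) + 2 + time n c1 + time n c2
  | For c => (n + 1) * (time n c + 5) + 4
  | _ => length (straight_code c)
  end.

(** * Correctness of the compiler *)

Section Compiler.
Variables (n B : nat) (a b : nat -> nat) (w : nat -> R).
Hypothesis B_large : 128 <= B.
Hypothesis dummy_weight : w n = 0%R.

(** [counts] records the countdowns of the enclosing loops, which are invisible in the source
    language but must survive the loop body. *)
Record represents (d : nat) (v counts : nat -> nat) (s : store) (M : nat -> nat)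
  (Rm : nat -> R) : Prop := {
  rep_n : M 0 = n;
  rep_one : M 1 = 1;
  rep_succ : M 2 = n + 1;
  rep_zero : M 3 = 0;
  rep_starts : M 4 = B;
  rep_ends : M 5 = B + 1;
  rep_members : M 6 = B + 2 * n + 2;
  rep_table : M 7 = n + 17;
  rep_bound : forall k, k < d -> v k <= n;
  rep_index : forall k, k < d -> M (index k) = v k;
  rep_row : forall k, k < d -> M (row k) = v k * (n + 1);
  rep_countdown : forall k, k < d -> M (countdown k) = counts k;
  rep_start : forall i, i <= n -> M (B + 2 * i) = a i;
  rep_end : forall i, i <= n -> M (B + 1 + 2 * i) = b i;
  rep_member : forall i, i <= n -> M (B + 2 * n + 2 + i) = Nat.b2n (members s i);
  rep_weight : forall i, i <= n -> Rm i = w i;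
  rep_scalar : forall c, c < 2 -> Rm (n + 1 + c) = scalars s c;
  rep_cell : forall i j, i <= n -> j <= n -> Rm (n + 17 + (i * (n + 1) + j)) = table s i j
}.

Lemma represents_frame d v counts s M Rm M' Rm' : represents d v counts s M Rm -> d <= 32 ->
  (forall x, x < 8 \/ 32 <= x < 32 + 3 * d \/ B <= x -> M' x = M x) ->
  (forall x, x < n + 3 \/ n + 17 <= x -> Rm' x = Rm x) ->
  represents d v counts s M' Rm'.
Proof.
  intros H Hd EM ER. destruct H. unfold index, row, countdown in *.
  split; intros; unfold index, row, countdown; rewrite ?EM, ?ER by lia; auto.
Qed.

Lemma compile_nat_correct d v counts s M Rm r x :
  represents d v counts s M Rm -> wf_nat d x = true -> 8 <= r < 32 ->
  let m := effects (compile_nat r x) (M, Rm) in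
  fst m r = eval_nat n a b v x /\ (forall y, y <> r -> fst m y = M y) /\ snd m = Rm.
Proof.
  intros H Hx Hr. destruct x as [k| |k|k]; cbn in Hx; try apply Nat.ltb_lt in Hx;
    cbn [compile_nat effects effect fst snd eval_nat].
  - upd_simpl. rewrite (rep_index _ _ _ _ _ _ H), (rep_zero _ _ _ _ _ _ H) by assumption.
    split; [lia|]. split; [|reflexivity]. intros. now upd_simpl.
  - upd_simpl. rewrite (rep_n _ _ _ _ _ _ H), (rep_zero _ _ _ _ _ _ H).
    split; [lia|]. split; [|reflexivity]. intros. now upd_simpl.
  - assert (Hk := rep_bound _ _ _ _ _ _ H k Hx).
    upd_simpl. rewrite (rep_index _ _ _ _ _ _ H), (rep_starts _ _ _ _ _ _ H) by assumption.
    upd_simpl. replace (v k + v k + B) with (B + 2 * v k) by lia.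
    rewrite (rep_start _ _ _ _ _ _ H) by assumption.
    split; [reflexivity|]. split; [|reflexivity]. intros. now upd_simpl.
  - assert (Hk := rep_bound _ _ _ _ _ _ H k Hx).
    upd_simpl. rewrite (rep_index _ _ _ _ _ _ H), (rep_ends _ _ _ _ _ _ H) by assumption.
    upd_simpl. replace (v k + v k + (B + 1)) with (B + 1 + 2 * v k) by lia.
    rewrite (rep_end _ _ _ _ _ _ H) by assumption.
    split; [reflexivity|]. split; [|reflexivity]. intros. now upd_simpl.
Qed.

Definition real_frame (t : nat) (m m' : memory) : Prop :=
  (forall y, y <> 8 -> y <> 9 -> fst m' y = fst m y) /\
  (forall y, y < n + 1 + t \/ n + 17 <= y -> snd m' y = snd m y).

Lemma compile_real_correct d v counts s : forall x t M Rm,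
  represents d v counts s M Rm -> d <= 32 -> wf_real d t x = true -> 2 <= t ->
  let m := effects (compile_real t x) (M, Rm) in
  snd m (n + 1 + t) = eval_real w v s x /\ real_frame t (M, Rm) m.
Proof.
  assert (LR : forall P M Rm t, represents d v counts s M Rm -> d <= 32 -> 2 <= t ->
    real_frame t (M, Rm) P -> represents d v counts s (fst P) (snd P)).
  { intros P M Rm t H Hd Ht [F1 F2]. cbn in *. eapply represents_frame; [exact H|assumption| |].
    - intros y Hy. apply F1; lia.
    - intros y Hy. apply F2. lia. }
  assert (BIN : forall op x y t M Rm,
    (forall t M Rm, represents d v counts s M Rm -> d <= 32 -> wf_real d t x = true -> 2 <= t ->
      let m := effects (compile_real t x) (M, Rm) in
      snd m (n + 1 + t) = eval_real w v s x /\ real_frame t (M, Rm) m) ->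
    (forall t M Rm, represents d v counts s M Rm -> d <= 32 -> wf_real d t y = true -> 2 <= t ->
      let m := effects (compile_real t y) (M, Rm) in
      snd m (n + 1 + t) = eval_real w v s y /\ real_frame t (M, Rm) m) ->
    represents d v counts s M Rm -> d <= 32 ->
    (t <? 16) && (wf_real d t x && wf_real d (S t) y) = true -> 2 <= t ->
    let m := effects (compile_real t x ++ compile_real (S t) y ++
       scalar_address 8 t ++ scalar_address 9 (S t) ++ [op : instr]) (M, Rm) in
    exists M' Rm', m = effect op (M', Rm') /\ t < 16 /\ M' 8 = n + 1 + t /\ M' 9 = n + 1 + S t /\
      Rm' (n + 1 + t) = eval_real w v s x /\ Rm' (n + 1 + S t) = eval_real w v s y /\
      real_frame t (M, Rm) (M', Rm')).
  { intros op x y t M Rm HX HY H Hd W Ht.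
    rewrite !andb_true_iff in W. destruct W as [W1 [W2 W3]]. apply Nat.ltb_lt in W1.
    rewrite !effects_app.
    destruct (HX t M Rm H Hd W2 Ht) as [E1 F1].
    set (m1 := effects (compile_real t x) (M, Rm)) in *.
    assert (H1 := LR _ _ _ _ H Hd Ht F1).
    destruct (HY (S t) (fst m1) (snd m1) H1 Hd W3 ltac:(lia)) as [E2 F2].
    rewrite <- surjective_pairing in E2, F2.
    set (m2 := effects (compile_real (S t) y) m1) in *.
    destruct m2 as [M2 R2]. destruct F1 as [F1 G1], F2 as [F2 G2]. cbn [fst snd] in *.
    assert (S2 : M2 2 = n + 1) by (rewrite F2, F1 by lia; apply (rep_succ _ _ _ _ _ _ H)).
    cbn [scalar_address effects effect].
    eexists _, _. split; [reflexivity|]. split; [assumption|]. upd_simpl. rewrite S2.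
    split; [lia|]. split; [lia|]. split; [rewrite G2 by lia; assumption|]. split; [assumption|].
    split; cbn [fst snd].
    - intros z Hz1 Hz2. upd_simpl. rewrite F2, F1 by assumption. reflexivity.
    - intros z Hz. rewrite G2, G1 by lia. reflexivity. }
  induction x as [|k|k l|c|x IHx y IHy|x IHx y IHy]; intros t M Rm H Hd W Ht.
  - cbn [wf_real] in W. apply andb_true_iff in W. destruct W as [W1 _]. apply Nat.ltb_lt in W1.
    cbn [compile_real scalar_address app effects effect fst snd eval_real].
    upd_simpl. rewrite (rep_succ _ _ _ _ _ _ H).
    replace (t + (n + 1)) with (n + 1 + t) by lia. upd_simpl. split; [reflexivity|].
    split; cbn [fst snd]; intros; upd_simpl; reflexivity.
  - cbn [wf_real] in W. apply andb_true_iff in W. destruct W as [W1 W]. apply Nat.ltb_lt in W1, W.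
    assert (Hk := rep_bound _ _ _ _ _ _ H k W). assert (II := rep_index _ _ _ _ _ _ H k W).
    cbn [compile_real scalar_address app effects effect fst snd eval_real].
    unfold index in *. upd_simpl. rewrite (rep_succ _ _ _ _ _ _ H).
    replace (t + (n + 1)) with (n + 1 + t) by lia. upd_simpl.
    rewrite II, (rep_n _ _ _ _ _ _ H).
    rewrite !(rep_weight _ _ _ _ _ _ H), dummy_weight by lia. split; [lra|].
    split; cbn [fst snd]; intros; upd_simpl; reflexivity.
  - cbn [wf_real] in W. rewrite !andb_true_iff in W. destruct W as [W1 [Wk Wl]].
    apply Nat.ltb_lt in W1, Wk, Wl.
    assert (Hk := rep_bound _ _ _ _ _ _ H k Wk). assert (Hl := rep_bound _ _ _ _ _ _ H l Wl).
    cbn [compile_real scalar_address table_address app effects effect fst snd eval_real].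
    assert (IR := rep_row _ _ _ _ _ _ H k Wk). assert (II := rep_index _ _ _ _ _ _ H l Wl).
    unfold row, index in *. upd_simpl. rewrite (rep_succ _ _ _ _ _ _ H).
    replace (t + (n + 1)) with (n + 1 + t) by lia. upd_simpl. rewrite IR, II.
    rewrite (rep_n _ _ _ _ _ _ H), (rep_table _ _ _ _ _ _ H).
    replace (v k * (n + 1) + v l + (n + 17)) with (n + 17 + (v k * (n + 1) + v l)) by lia.
    rewrite (rep_cell _ _ _ _ _ _ H), (rep_weight _ _ _ _ _ _ H), dummy_weight by lia.
    split; [lra|]. split; cbn [fst snd]; intros; upd_simpl; reflexivity.
  - cbn [wf_real] in W. rewrite !andb_true_iff in W. destruct W as [W1 Wc].
    apply Nat.ltb_lt in W1, Wc.
    cbn [compile_real scalar_address app effects effect fst snd eval_real].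
    upd_simpl. rewrite (rep_succ _ _ _ _ _ _ H).
    replace (t + (n + 1)) with (n + 1 + t) by lia.
    replace (c + (n + 1)) with (n + 1 + c) by lia. upd_simpl.
    rewrite (rep_n _ _ _ _ _ _ H).
    rewrite (rep_scalar _ _ _ _ _ _ H), (rep_weight _ _ _ _ _ _ H), dummy_weight by lia.
    split; [lra|]. split; cbn [fst snd]; intros; upd_simpl; reflexivity.
  - destruct (BIN (RAdd 8 8 9) x y t M Rm IHx IHy H Hd W Ht)
      as (M' & Rm' & E & Ht' & E8 & E9 & EX & EY & [F1 F2]).
    cbn [compile_real]. rewrite E. cbn [effect fst snd eval_real].
    rewrite E8, E9, EX, EY. upd_simpl. split; [reflexivity|].
    cbn in F1, F2. split; cbn [fst snd]; intros; upd_simpl; auto.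
  - destruct (BIN (RSub 8 8 9) x y t M Rm IHx IHy H Hd W Ht)
      as (M' & Rm' & E & Ht' & E8 & E9 & EX & EY & [F1 F2]).
    cbn [compile_real]. rewrite E. cbn [effect fst snd eval_real].
    rewrite E8, E9, EX, EY. upd_simpl. split; [reflexivity|].
    cbn in F1, F2. split; cbn [fst snd]; intros; upd_simpl; auto.
Qed.

Definition bool_frame (t : nat) (m m' : memory) : Prop :=
  (forall y, y < 8 \/ 10 <= y < t \/ 32 <= y -> fst m' y = fst m y) /\
  (forall y, y < n + 3 \/ n + 17 <= y -> snd m' y = snd m y).

Lemma bool_frame_represents d v counts s t M Rm m :
  represents d v counts s M Rm -> d <= 32 -> bool_frame t (M, Rm) m ->
  represents d v counts s (fst m) (snd m).
Proof.
  intros H Hd [F1 F2]. cbn in *. eapply represents_frame; [exact H|assumption| |].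
  - intros y Hy. apply F1; lia.
  - intros y Hy. apply F2. lia.
Qed.

Lemma compile_bool_correct d v counts s : forall x t M Rm,
  represents d v counts s M Rm -> d <= 32 -> wf_bool d t x = true -> 10 <= t ->
  let m := effects (compile_bool t x) (M, Rm) in
  fst m t = Nat.b2n (eval_bool n a b w v s x) /\ bool_frame t (M, Rm) m.
Proof.
  assert (BIN : forall ops x y t M Rm,
    (forall t M Rm, represents d v counts s M Rm -> d <= 32 -> wf_bool d t x = true -> 10 <= t ->
      let m := effects (compile_bool t x) (M, Rm) in
      fst m t = Nat.b2n (eval_bool n a b w v s x) /\ bool_frame t (M, Rm) m) ->
    (forall t M Rm, represents d v counts s M Rm -> d <= 32 -> wf_bool d t y = true -> 10 <= t ->
      let m := effects (compile_bool t y) (M, Rm) in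
      fst m t = Nat.b2n (eval_bool n a b w v s y) /\ bool_frame t (M, Rm) m) ->
    represents d v counts s M Rm -> d <= 32 ->
    (t <? 32) && (wf_bool d t x && wf_bool d (S t) y) = true -> 10 <= t ->
    let m := effects (compile_bool t x ++ compile_bool (S t) y ++ ops) (M, Rm) in
    exists M' Rm', m = effects ops (M', Rm') /\ M' t = Nat.b2n (eval_bool n a b w v s x) /\
      M' (S t) = Nat.b2n (eval_bool n a b w v s y) /\ M' 1 = 1 /\ t < 32 /\
      bool_frame t (M, Rm) (M', Rm')).
  { intros ops x y t M Rm HX HY H Hd W Ht.
    rewrite !andb_true_iff in W. destruct W as [W1 [W2 W3]]. apply Nat.ltb_lt in W1.
    rewrite !effects_app.
    destruct (HX t M Rm H Hd W2 Ht) as [E1 F1].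
    set (m1 := effects (compile_bool t x) (M, Rm)) in *.
    assert (H1 := bool_frame_represents _ _ _ _ _ _ _ _ H Hd F1).
    destruct (HY (S t) (fst m1) (snd m1) H1 Hd W3 ltac:(lia)) as [E2 F2].
    rewrite <- surjective_pairing in E2, F2.
    set (m2 := effects (compile_bool (S t) y) m1) in *.
    destruct m2 as [M2 R2]. destruct F1 as [F1 G1], F2 as [F2 G2]. cbn [fst snd] in *.
    exists M2, R2. split; [reflexivity|]. split; [rewrite F2 by lia; assumption|].
    split; [assumption|].
    split; [rewrite F2, F1 by lia; apply (rep_one _ _ _ _ _ _ H)|]. split; [assumption|].
    split; cbn [fst snd].
    - intros z Hz. rewrite F2, F1 by lia. reflexivity.
    - intros z Hz. rewrite G2, G1 by lia. reflexivity. }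
  induction x as [x y|x y|k|x IHx|x IHx y IHy|x IHx y IHy]; intros t M Rm H Hd W Ht.
  - cbn [wf_bool] in W. rewrite !andb_true_iff in W. destruct W as [W1 [Wx Wy]].
    apply Nat.ltb_lt in W1.
    cbn [compile_bool]. rewrite !effects_app.
    destruct (compile_nat_correct d v counts s M Rm 8 x H Wx ltac:(lia)) as (E1 & F1 & G1).
    set (m1 := effects (compile_nat 8 x) (M, Rm)) in *.
    assert (H1 : represents d v counts s (fst m1) (snd m1)).
    { eapply represents_frame; [exact H|assumption| |].
      - intros z Hz. apply F1; lia.
      - intros z Hz. now rewrite G1. }
    destruct (compile_nat_correct d v counts s _ _ 9 y H1 Wy ltac:(lia)) as (E2 & F2 & G2).
    rewrite <- surjective_pairing in E2, F2, G2.
    set (m2 := effects (compile_nat 9 y) m1) in *. destruct m2 as [M2 R2].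
    cbn [fst snd] in *. cbn [effects effect fst snd].
    assert (E1' : M2 8 = eval_nat n a b v x) by (rewrite F2 by lia; exact E1).
    assert (O : M2 1 = 1) by (rewrite F2, F1 by lia; apply (rep_one _ _ _ _ _ _ H)).
    split.
    + upd_simpl. rewrite E1', E2, O. cbn [eval_bool].
      destruct (Nat.leb_spec (eval_nat n a b v x) (eval_nat n a b v y)); cbn [Nat.b2n]; lia.
    + split; cbn [fst snd]; [|intros; congruence].
      intros z Hz. upd_simpl. rewrite F2, F1 by lia. reflexivity.
  - cbn [wf_bool] in W. rewrite !andb_true_iff in W. destruct W as [W1 [Wx Wy]].
    apply Nat.ltb_lt in W1.
    cbn [compile_bool]. rewrite !effects_app.
    destruct (compile_real_correct d v counts s x 2 M Rm H Hd Wx ltac:(lia)) as [E1 [F1 G1]].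
    set (m1 := effects (compile_real 2 x) (M, Rm)) in *. cbn [fst snd] in F1, G1.
    assert (H1 : represents d v counts s (fst m1) (snd m1)).
    { eapply represents_frame; [exact H|assumption| |].
      - intros z Hz. apply F1; lia.
      - intros z Hz. apply G1. lia. }
    destruct (compile_real_correct d v counts s y 3 _ _ H1 Hd Wy ltac:(lia)) as [E2 [F2 G2]].
    rewrite <- surjective_pairing in E2, F2, G2.
    set (m2 := effects (compile_real 3 y) m1) in *. destruct m2 as [M2 R2].
    cbn [fst snd] in *. cbn [scalar_address effects effect fst snd].
    assert (S2 : M2 2 = n + 1) by (rewrite F2, F1 by lia; apply (rep_succ _ _ _ _ _ _ H)).
    split.
    + upd_simpl. rewrite S2.
      replace (2 + (n + 1)) with (n + 1 + 2) by lia. replace (3 + (n + 1)) with (n + 1 + 3) by lia.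
      rewrite E2. rewrite G2 by lia. rewrite E1. cbn [eval_bool]. unfold Rleb.
      destruct (Rle_dec (eval_real w v s x) (eval_real w v s y)); reflexivity.
    + split; cbn [fst snd].
      * intros z Hz. upd_simpl. rewrite F2, F1 by lia. reflexivity.
      * intros z Hz. rewrite G2, G1 by lia. reflexivity.
  - cbn [wf_bool] in W. rewrite !andb_true_iff in W. destruct W as [W1 Wk].
    apply Nat.ltb_lt in W1, Wk. assert (Hk := rep_bound _ _ _ _ _ _ H k Wk).
    cbn [compile_bool effects effect fst snd eval_bool]. upd_simpl.
    rewrite (rep_members _ _ _ _ _ _ H), (rep_index _ _ _ _ _ _ H) by assumption.
    upd_simpl. replace (v k + (B + 2 * n + 2)) with (B + 2 * n + 2 + v k) by lia.
    rewrite (rep_member _ _ _ _ _ _ H) by assumption. split; [reflexivity|].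
    split; cbn [fst snd]; intros; upd_simpl; reflexivity.
  - cbn [wf_bool] in W. apply andb_true_iff in W. destruct W as [W1 W].
    apply Nat.ltb_lt in W1. cbn [compile_bool]. rewrite effects_app.
    destruct (IHx t M Rm H Hd W Ht) as [E [F G]].
    set (m := effects (compile_bool t x) (M, Rm)) in *. destruct m as [M' R'].
    cbn [fst snd] in *. cbn [effects effect fst snd eval_bool]. upd_simpl.
    rewrite E, (F 1), (rep_one _ _ _ _ _ _ H) by lia.
    split; [destruct (eval_bool n a b w v s x); reflexivity|].
    split; cbn [fst snd]; intros; upd_simpl; auto.
  - destruct (BIN [NAdd t t (S t); NSub t t 1] x y t M Rm IHx IHy H Hd W Ht)
      as (M' & Rm' & E & EX & EY & E1 & Ht' & [F1 F2]).
    cbn [compile_bool]. rewrite E. cbn [effects effect fst snd eval_bool]. upd_simpl.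
    rewrite EX, EY, E1. cbn in F1, F2.
    split; [destruct (eval_bool n a b w v s x), (eval_bool n a b w v s y); reflexivity|].
    split; cbn [fst snd]; intros; upd_simpl; auto.
  - destruct (BIN [NAdd t t (S t); NSub t 1 t; NSub t 1 t] x y t M Rm IHx IHy H Hd W Ht)
      as (M' & Rm' & E & EX & EY & E1 & Ht' & [F1 F2]).
    cbn [compile_bool]. rewrite E. cbn [effects effect fst snd eval_bool]. upd_simpl.
    rewrite EX, EY, E1. cbn in F1, F2.
    split; [destruct (eval_bool n a b w v s x), (eval_bool n a b w v s y); reflexivity|].
    split; cbn [fst snd]; intros; upd_simpl; auto.
Qed.

Lemma represents_scalar d v counts s M Rm c x : represents d v counts s M Rm -> c < 2 ->
  represents d v counts (mkStore (members s) (table s) (upd (scalars s) c x)) M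
    (upd Rm (n + 1 + c) x).
Proof.
  intros [] Hc. split; auto; cbn [members table scalars].
  - intros i Hi. upd_simpl. auto.
  - intros c' Hc'. destruct (Nat.eq_dec c' c) as [->|]; upd_simpl; auto.
  - intros i j Hi Hj. upd_simpl. auto.
Qed.

Lemma represents_table d v counts s M Rm i j x : represents d v counts s M Rm ->
  i <= n -> j <= n ->
  represents d v counts (mkStore (members s) (upd (table s) i (upd (table s i) j x)) (scalars s)) M
    (upd Rm (n + 17 + (i * (n + 1) + j)) x).
Proof.
  intros [] Hi Hj. split; auto; cbn [members table scalars].
  - intros k Hk. upd_simpl. auto.
  - intros k Hk. upd_simpl. auto.
  - intros i' j' Hi' Hj'. destruct (Nat.eq_dec i' i) as [->|Hne].
    + upd_simpl. destruct (Nat.eq_dec j' j) as [->|]; upd_simpl; auto.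
    + rewrite (upd_other (table s)) by assumption. rewrite upd_other; [auto|].
      (* Columns are at most [n] and rows have stride [n + 1], so an address determines its row. *)
      intros E. apply Hne. nia.
Qed.

Lemma represents_member d v counts s M Rm i x : represents d v counts s M Rm -> d <= 32 -> i <= n ->
  represents d v counts (mkStore (upd (members s) i x) (table s) (scalars s))
    (upd M (B + 2 * n + 2 + i) (Nat.b2n x)) Rm.
Proof.
  intros [] Hd Hi. unfold index, row, countdown in *.
  split; auto; cbn [members table scalars]; unfold index, row, countdown;
    try (intros; upd_simpl; now auto).
  intros k Hk. destruct (Nat.eq_dec k i) as [->|]; upd_simpl; auto.
Qed.

Lemma represents_scratch d v counts s M Rm M' : represents d v counts s M Rm -> d <= 32 ->
  (forall y, y <> 8 -> y <> 9 -> M' y = M y) -> represents d v counts s M' Rm.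
Proof.
  intros H Hd E. eapply represents_frame; [exact H|assumption| |reflexivity].
  intros y Hy. apply E; lia.
Qed.

Lemma straight_code_correct d v counts s M Rm c :
  match c with SetScalar _ _ | SetTable _ _ _ | SetMember _ _ => True | _ => False end ->
  represents d v counts s M Rm -> d <= 32 -> wf_cmd d c = true ->
  let m := effects (straight_code c) (M, Rm) in
  represents d v counts (run n a b w d c v s) (fst m) (snd m).
Proof.
  assert (VAL : forall x M Rm, represents d v counts s M Rm -> d <= 32 ->
    wf_real d 2 x = true -> let m := effects (compile_real 2 x) (M, Rm) in
    represents d v counts s (fst m) (snd m) /\ snd m (n + 3) = eval_real w v s x).
  { intros x M' R' H Hd W.
    destruct (compile_real_correct d v counts s x 2 M' R' H Hd W ltac:(lia)) as [E [F G]].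
    split; [|replace (n + 3) with (n + 1 + 2) by lia; exact E].
    eapply represents_frame; [exact H|assumption| |].
    - intros z Hz. apply F; lia.
    - intros z Hz. apply G. lia. }
  intros Hc H Hd W. destruct c as [| | | |c x|k l x|k x]; try contradiction; cbn [wf_cmd] in W.
  - apply andb_true_iff in W. destruct W as [Wc Wx]. apply Nat.ltb_lt in Wc.
    cbn [straight_code run]. rewrite !effects_app.
    destruct (VAL x M Rm H Hd Wx) as [H1 E1]. destruct (effects (compile_real 2 x) (M, Rm)) as [M1 R1].
    cbn [fst snd] in *. cbn [scalar_address effects effect fst snd]. upd_simpl.
    rewrite (rep_n _ _ _ _ _ _ H1), (rep_succ _ _ _ _ _ _ H1).
    replace (c + (n + 1)) with (n + 1 + c) by lia. replace (2 + (n + 1)) with (n + 3) by lia.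
    rewrite E1, (rep_weight _ _ _ _ _ _ H1), dummy_weight, Rplus_0_r by lia.
    apply represents_scalar; [|assumption].
    eapply represents_scratch; [exact H1|assumption|]. intros; upd_simpl; reflexivity.
  - rewrite !andb_true_iff in W. destruct W as [[Wk Wl] Wx]. apply Nat.ltb_lt in Wk, Wl.
    cbn [straight_code run]. rewrite !effects_app.
    destruct (VAL x M Rm H Hd Wx) as [H1 E1]. destruct (effects (compile_real 2 x) (M, Rm)) as [M1 R1].
    cbn [fst snd] in *. cbn [table_address scalar_address effects effect fst snd].
    assert (IR := rep_row _ _ _ _ _ _ H1 k Wk). assert (II := rep_index _ _ _ _ _ _ H1 l Wl).
    unfold row, index in IR, II |- *. upd_simpl. rewrite IR, II.
    rewrite (rep_n _ _ _ _ _ _ H1), (rep_succ _ _ _ _ _ _ H1), (rep_table _ _ _ _ _ _ H1).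
    replace (v k * (n + 1) + v l + (n + 17)) with (n + 17 + (v k * (n + 1) + v l)) by lia.
    replace (2 + (n + 1)) with (n + 3) by lia.
    rewrite E1, (rep_weight _ _ _ _ _ _ H1), dummy_weight, Rplus_0_r by lia.
    apply represents_table; [|eapply rep_bound; eassumption..].
    eapply represents_scratch; [exact H1|assumption|]. intros; upd_simpl; reflexivity.
  - apply Nat.ltb_lt in W. cbn [straight_code run effects effect fst snd].
    assert (II := rep_index _ _ _ _ _ _ H k W). unfold index in II |- *. upd_simpl.
    rewrite II, (rep_members _ _ _ _ _ _ H).
    replace (v k + (B + 2 * n + 2)) with (B + 2 * n + 2 + v k) by lia.
    apply represents_member; [|assumption|eapply rep_bound; eassumption].
    eapply represents_scratch; [exact H|assumption|]. intros; upd_simpl; reflexivity.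
Qed.

Lemma represents_push d v counts s M Rm i k : represents d v counts s M Rm -> i <= n ->
  M (index d) = i -> M (row d) = i * (n + 1) -> M (countdown d) = k ->
  represents (S d) (upd v d i) (upd counts d k) s M Rm.
Proof.
  intros [] Hi E1 E2 E3.
  split; auto; intros k' Hk'; (destruct (Nat.eq_dec k' d) as [->|]; upd_simpl; auto with arith);
    match goal with H : forall k, k < d -> _ |- _ => apply H; lia end.
Qed.

Lemma represents_pop d v counts s M Rm i k :
  represents (S d) (upd v d i) (upd counts d k) s M Rm -> represents d v counts s M Rm.
Proof.
  intros []. split; auto; intros k' Hk'.
  - rewrite <- (upd_other v d i) by lia. auto with arith.
  - rewrite <- (upd_other v d i k') by lia. auto with arith.
  - rewrite <- (upd_other v d i k') by lia. auto with arith.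
  - rewrite <- (upd_other counts d k k') by lia. auto with arith.
Qed.

Lemma compile_correct P c : forall p d v counts s M Rm,
  code_at P p (compile p d c) -> wf_cmd d c = true -> d <= 32 -> represents d v counts s M Rm ->
  exists t M' Rm', t <= time n c /\
    exec P t (mkState p M Rm) = mkState (p + code_size c) M' Rm' /\
    represents d v counts (run n a b w d c v s) M' Rm'.
Proof.
  assert (STR : forall c p d v counts s M Rm,
    match c with SetScalar _ _ | SetTable _ _ _ | SetMember _ _ => True | _ => False end ->
    code_at P p (straight_code c) -> wf_cmd d c = true -> d <= 32 -> represents d v counts s M Rm ->
    exists t M' Rm', t <= length (straight_code c) /\
      exec P t (mkState p M Rm) = mkState (p + length (straight_code c)) M' Rm' /\
      represents d v counts (run n a b w d c v s) M' Rm').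
  { intros c0 p d v counts s M Rm Hc C W Hd H.
    exists (length (straight_code c0)). eexists _, _. split; [lia|]. split.
    - apply exec_straight; [assumption|apply straight_code_straight].
    - now apply straight_code_correct. }
  induction c as [|c1 IH1 c2 IH2|x c1 IH1 c2 IH2|c IH|c x|k l x|k x];
    intros p d v counts s M Rm C W Hd H.
  - exists 0, M, Rm. cbn. rewrite Nat.add_0_r. split; [lia|]. now split.
  - cbn [compile] in C. apply code_at_app in C. destruct C as [C1 C2].
    rewrite compile_length in C2. cbn [wf_cmd] in W. apply andb_true_iff in W. destruct W as [W1 W2].
    destruct (IH1 p d v counts s M Rm C1 W1 Hd H) as (t1 & M1 & R1 & T1 & E1 & H1).
    destruct (IH2 _ d v counts _ M1 R1 C2 W2 Hd H1) as (t2 & M2 & R2 & T2 & E2 & H2).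
    exists (t1 + t2), M2, R2. cbn [time code_size run]. split; [lia|]. split; [|assumption].
    rewrite exec_add, E1, E2. f_equal. lia.
  - cbn [compile] in C. set (lb := length (compile_bool 10 x)) in *.
    apply code_at_app in C. destruct C as [Cb C]. cbn [app] in C.
    apply code_at_cons in C. destruct C as [CJ C]. apply code_at_app in C. destruct C as [C1 C].
    rewrite compile_length in C. apply code_at_cons in C. destruct C as [CK C2].
    fold lb in CJ, C1, CK, C2.
    replace (S (p + lb)) with (p + lb + 1) in C1, CK, C2 by lia.
    replace (S (p + lb + 1 + code_size c1)) with (p + lb + 2 + code_size c1) in C2 by lia.
    cbn [wf_cmd] in W. rewrite !andb_true_iff in W. destruct W as [[Wx W1] W2].
    destruct (compile_bool_correct d v counts s x 10 M Rm H Hd Wx ltac:(lia)) as [EB FB].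
    assert (HB := bool_frame_represents _ _ _ _ _ _ _ _ H Hd FB).
    assert (XB := exec_straight P p _ M Rm Cb (compile_bool_straight x 10)). fold lb in XB.
    destruct (effects (compile_bool 10 x) (M, Rm)) as [MB RB]. cbn [fst snd] in *.
    assert (XJ := exec_jump P _ MB RB _ _ CJ). rewrite EB in XJ.
    cbn [run time code_size]. fold lb. destruct (eval_bool n a b w v s x); cbn [Nat.b2n Nat.eqb] in XJ.
    + replace (S (p + lb)) with (p + lb + 1) in XJ by lia.
      destruct (IH1 _ d v counts s MB RB C1 W1 Hd HB) as (t1 & M1 & R1 & T1 & E1 & H1).
      assert (XK := exec_jump P _ M1 R1 _ _ CK). rewrite (rep_zero _ _ _ _ _ _ H1) in XK.
      exists (lb + (1 + (t1 + 1))), M1, R1. split; [lia|]. split; [|assumption].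
      rewrite exec_add, XB, exec_add, XJ, exec_add, E1, XK. cbn [Nat.eqb]. f_equal. lia.
    + destruct (IH2 _ d v counts s MB RB C2 W2 Hd HB) as (t2 & M2 & R2 & T2 & E2 & H2).
      exists (lb + (1 + t2)), M2, R2. split; [lia|]. split; [|assumption].
      rewrite exec_add, XB, exec_add, XJ, E2. f_equal. lia.
  - cbn [compile] in C. cbn [wf_cmd] in W. apply andb_true_iff in W. destruct W as [Wd W].
    apply Nat.ltb_lt in Wd. cbn [time code_size run].
    set (f := fun i s => run n a b w (S d) c (upd v d i) s).
    change ([NConst (index d) 0; NConst (row d) 0; NAdd (countdown d) 2 3;
             NJz (countdown d) (p + 8 + code_size c)] ++ ?r) with
      ([NConst (index d) 0; NConst (row d) 0; NAdd (countdown d) 2 3] ++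
       (NJz (countdown d) (p + 8 + code_size c) :: r)) in C.
    apply code_at_app in C. destruct C as [C0 C]. cbn [length] in C.
    apply code_at_cons in C. destruct C as [CJ C]. apply code_at_app in C. destruct C as [CB C].
    rewrite compile_length in C.
    replace (S (p + 3)) with (p + 4) in CB, C by lia.
    change [NAdd (index d) (index d) 1; NAdd (row d) (row d) 2;
       NSub (countdown d) (countdown d) 1; NJz 3 (p + 3)] with
      ([NAdd (index d) (index d) 1; NAdd (row d) (row d) 2;
       NSub (countdown d) (countdown d) 1] ++ [NJz 3 (p + 3)]) in C.
    apply code_at_app in C. destruct C as [CI CE]. cbn [length] in CE.
    apply code_at_cons in CE. destruct CE as [CE _].
    (* Induction on the number [k] of iterations still to run, which is the content of the countdown
       register; [i] iterations are done. *)
    assert (LOOP : forall k i M Rm, i + k = S n -> represents d v counts (loop i f s) M Rm ->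
      M (index d) = i -> M (row d) = i * (n + 1) -> M (countdown d) = k ->
      exists t M' Rm', t <= k * (time n c + 5) + 1 /\
        exec P t (mkState (p + 3) M Rm) = mkState (p + 8 + code_size c) M' Rm' /\
        represents d v counts (loop (S n) f s) M' Rm').
    { induction k as [|k IHk]; intros i M0 R0 Hik H0 EI ER EC;
        assert (XJ := exec_jump P _ M0 R0 _ _ CJ); rewrite EC in XJ; cbn [Nat.eqb] in XJ.
      - exists 1, M0, R0. split; [lia|]. split; [assumption|].
        now replace (S n) with i by lia.
      - replace (S (p + 3)) with (p + 4) in XJ by lia.
        assert (H1 := represents_push _ _ _ _ _ _ i (S k) H0 ltac:(lia) EI ER EC).
        destruct (IH _ (S d) _ _ _ M0 R0 CB W ltac:(lia) H1) as (t1 & M1 & R1 & T1 & E1 & H2).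
        assert (E2 := exec_straight P _ _ M1 R1 CI eq_refl).
        cbn [length effects effect fst snd] in E2.
        assert (II := rep_index _ _ _ _ _ _ H2 d ltac:(lia)).
        assert (IR := rep_row _ _ _ _ _ _ H2 d ltac:(lia)).
        assert (IC := rep_countdown _ _ _ _ _ _ H2 d ltac:(lia)).
        assert (I1 := rep_one _ _ _ _ _ _ H2). assert (I2 := rep_succ _ _ _ _ _ _ H2).
        rewrite upd_same in II, IR, IC.
        match type of E2 with _ = mkState _ ?m _ => set (M2 := m) in * end.
        assert (H3 : represents d v counts (loop (S i) f s) M2 R1).
        { cbn [loop]. apply represents_pop in H2.
          eapply represents_frame; [exact H2|lia| |reflexivity].
          intros y Hy. unfold M2, index, row, countdown. upd_simpl. reflexivity. }
        assert (XE := exec_jump P _ M2 R1 _ _ CE).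
        rewrite (rep_zero _ _ _ _ _ _ H3) in XE. cbn [Nat.eqb] in XE.
        destruct (IHk (S i) M2 R1) as (t3 & M3 & R3 & T3 & E3 & H4); [lia|assumption|..].
        + unfold M2, index, row, countdown in *. upd_simpl. lia.
        + unfold M2, index, row, countdown in *. upd_simpl. lia.
        + unfold M2, index, row, countdown in *. upd_simpl. lia.
        + exists (1 + (t1 + (3 + (1 + t3)))), M3, R3. split; [lia|]. split; [|assumption].
          rewrite exec_add, XJ, exec_add, E1, exec_add, E2, exec_add, XE. assumption. }
    assert (E0 := exec_straight P _ _ M Rm C0 eq_refl). cbn [length effects effect fst snd] in E0.
    match type of E0 with _ = mkState _ ?m _ => set (M1 := m) in * end.
    assert (I2 := rep_succ _ _ _ _ _ _ H). assert (I3 := rep_zero _ _ _ _ _ _ H).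
    destruct (LOOP (S n) 0 M1 Rm) as (t & M2 & R2 & T & E & H2).
    + lia.
    + cbn [loop]. eapply represents_frame; [exact H|lia| |reflexivity].
      intros y Hy. unfold M1, index, row, countdown. upd_simpl. reflexivity.
    + unfold M1, index, row, countdown in *. upd_simpl. lia.
    + unfold M1, index, row, countdown in *. upd_simpl. lia.
    + unfold M1, index, row, countdown in *. upd_simpl. lia.
    + exists (3 + t), M2, R2. split; [lia|]. split; [|assumption].
      rewrite exec_add, E0, E. f_equal. lia.
  - now apply (STR (SetScalar c x)).
  - now apply (STR (SetTable k l x)).
  - now apply (STR (SetMember k x)).
Qed.
End Compiler.

Lemma time_polynomial c : exists C k, forall n, time n c <= C * (n + 1) ^ k.
Proof.
  assert (ST : forall m, exists C k, forall n : nat, m <= C * (n + 1) ^ k).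
  { intros m. exists m, 0. intros n. cbn. lia. }
  assert (MONO : forall n k k', k <= k' -> (n + 1) ^ k <= (n + 1) ^ k').
  { intros. apply Nat.pow_le_mono_r; lia. }
  induction c as [|c1 IH1 c2 IH2|x c1 IH1 c2 IH2|c IH|c x|k l x|k x]; cbn [time]; try apply ST.
  - destruct IH1 as (C1 & k1 & H1), IH2 as (C2 & k2 & H2).
    exists (C1 + C2), (k1 + k2). intros n. specialize (H1 n). specialize (H2 n).
    assert (M1 := MONO n k1 (k1 + k2) ltac:(lia)). assert (M2 := MONO n k2 (k1 + k2) ltac:(lia)).
    apply (Nat.mul_le_mono_l _ _ C1) in M1. apply (Nat.mul_le_mono_l _ _ C2) in M2. lia.
  - destruct IH1 as (C1 & k1 & H1), IH2 as (C2 & k2 & H2).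
    exists (length (compile_bool 10 x) + 2 + C1 + C2), (k1 + k2). intros n.
    specialize (H1 n). specialize (H2 n).
    assert (M0 := MONO n 0 (k1 + k2) ltac:(lia)). cbn [Nat.pow] in M0.
    assert (M1 := MONO n k1 (k1 + k2) ltac:(lia)). assert (M2 := MONO n k2 (k1 + k2) ltac:(lia)).
    apply (Nat.mul_le_mono_l _ _ C1) in M1. apply (Nat.mul_le_mono_l _ _ C2) in M2.
    apply (Nat.mul_le_mono_l _ _ (length (compile_bool 10 x) + 2)) in M0. lia.
  (* The 9 collects 5 instructions of overhead per iteration and 4 for entering and leaving the
     loop. *)
  - destruct IH as (C & k & H). exists (C + 9), (S k). intros n. specialize (H n).
    assert (M0 := MONO n 0 k ltac:(lia)). cbn [Nat.pow] in *.
    apply (Nat.mul_le_mono_l _ _ (n + 1)) in H.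
    apply (Nat.mul_le_mono_l _ _ (n + 1)) in M0. nia.
Qed.

(** * Input and output *)

(* The input occupies the registers, so it is first copied to [128 n, ...).  Register 0, the only
   one known to hold [n], is doubled into a free address before any other register is touched. *)
Definition save_registers (m : nat) : list instr :=
  flat_map (fun i => [NAdd 0 0 1; NStore 0 i]) (List.seq 2 m).

Definition save_code : list instr :=
  repeat (NAdd 0 0 0) 7 ++ [NStore 0 1; NConst 1 1] ++ save_registers 5 ++
  [NConst 2 5; NSub 0 0 2; NConst 3 0; NAdd 5 0 3; NConst 2 128; NConst 6 0].

(** Doubling has overwritten [n] by [128 * n], and there is no division; repeated subtraction of 128
    recovers [n] in register 6. *)
Definition divide_loop (q : nat) : list instr :=
  [NJz 0 (q + 4); NSub 0 0 2; NAdd 6 6 1; NJz 3 q].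

(* Only the registers 0..4 are used: for [2 <= n] they do not meet the output cells. *)
Definition copy_loop (q : nat) : list instr :=
  [NJz 4 (q + 8); NLoad 3 0; NStore 2 3; NConst 3 0; NAdd 0 0 1; NAdd 2 2 1; NSub 4 4 1; NJz 3 q].

(** The instances with [n = 0] and [n = 1] leave early; for [n = 1] the output cell 3 would collide
    with the registers of the copy loop. Cells 1 to 6 are saved first, since the setup works in
    them, and the loop copies the [2 * n - 4] cells from 7 on. That goes two cells past the input,
    whose zeros become the dummy interval. *)
Definition setup_code (halt : nat) : list instr :=
  [NJz 0 halt] ++ save_code ++ divide_loop 26 ++ [NSub 4 6 1] ++ [NJz 4 halt] ++
  [NConst 2 6; NAdd 2 2 5; NConst 0 4; NAdd 4 6 6; NSub 4 4 0; NConst 0 7] ++ copy_loop 38 ++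
  [NAdd 0 6 3; NAdd 2 0 1; NAdd 4 5 3; NAdd 5 4 1; NAdd 6 4 2; NAdd 6 6 2; NConst 7 16; NAdd 7 7 2].

Definition output_code (q : nat) : list instr :=
  [NAdd 4 0 3; NAdd 2 2 0; NAdd 0 6 3] ++ copy_loop (q + 3).

(** The setup takes 54 instructions and the output 11. The program halts by running past its end. *)
Definition full_program (c : cmd) : program :=
  setup_code (65 + code_size c) ++ compile 54 0 c ++ output_code (54 + code_size c).

Lemma full_program_length c : length (full_program c) = 65 + code_size c.
Proof.
  unfold full_program. rewrite !length_app, compile_length.
  change (length (setup_code _)) with 54. change (length (output_code _)) with 11. lia.
Qed.

Lemma code_at_whole P : code_at P 0 P.
Proof. intros i x H. exact H. Qed.

Lemma effects_double k M Rm : let m := effects (repeat (NAdd 0 0 0) k) (M, Rm) in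
  fst m 0 = 2 ^ k * M 0 /\ (forall y, y <> 0 -> fst m y = M y) /\ snd m = Rm.
Proof.
  revert M. induction k as [|k IH]; intros M; cbn [repeat effects effect].
  - cbn. auto.
  - destruct (IH (upd M 0 (M 0 + M 0))) as (E & F & G). rewrite E, upd_same.
    split; [cbn [Nat.pow]; lia|]. split; [|assumption].
    intros y Hy. rewrite F by assumption. now upd_simpl.
Qed.

Lemma effects_save m M Rm : M 1 = 1 -> m + 1 <= M 0 ->
  let m' := effects (save_registers m) (M, Rm) in
  fst m' 0 = M 0 + m /\ (forall j, j < m -> fst m' (M 0 + 1 + j) = M (2 + j)) /\
  (forall y, y <> 0 -> y <= M 0 \/ M 0 + m < y -> fst m' y = M y) /\ snd m' = Rm.
Proof.
  intros H1. unfold save_registers. induction m as [|m IH]; intros Hm.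
  - cbn. repeat split; auto; lia.
  - rewrite seq_S, flat_map_app, effects_app. destruct IH as (E & F & G & K); [lia|].
    set (m' := effects _ (M, Rm)) in *. destruct m' as [M' R'].
    cbn [fst snd] in *. cbn [flat_map app effects effect fst snd]. upd_simpl.
    rewrite E, (G 1), H1 by lia.
    replace (M 0 + m + 1) with (M 0 + 1 + m) by lia. upd_simpl.
    split; [lia|]. split; [|split; [|assumption]].
    + intros j Hj. destruct (Nat.eq_dec j m) as [->|]; upd_simpl.
      * rewrite (G (2 + m)) by lia. reflexivity.
      * apply F. lia.
    + intros y Hy Hy'. upd_simpl. apply G; lia.
Qed.

Lemma divide_loop_correct P q Rm : code_at P q (divide_loop q) -> forall k M,
  M 0 = 128 * k -> M 1 = 1 -> M 2 = 128 -> M 3 = 0 ->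
  exists t M', t <= 4 * k + 1 /\ exec P t (mkState q M Rm) = mkState (q + 4) M' Rm /\
    M' 6 = M 6 + k /\ forall y, y <> 0 -> y <> 6 -> M' y = M y.
Proof.
  intros C. unfold divide_loop in C. apply code_at_cons in C. destruct C as [CJ C].
  change [NSub 0 0 2; NAdd 6 6 1; NJz 3 q] with ([NSub 0 0 2; NAdd 6 6 1] ++ [NJz 3 q]) in C.
  apply code_at_app in C. destruct C as [C CE]. apply code_at_cons in CE. destruct CE as [CE _].
  induction k as [|k IH]; intros M H0 H1 H2 H3; assert (XJ := exec_jump P _ M Rm _ _ CJ).
  - rewrite H0 in XJ. exists 1, M. repeat split; auto; lia.
  - rewrite (proj2 (Nat.eqb_neq (M 0) 0)) in XJ by lia.
    assert (X := exec_straight P _ _ M Rm C eq_refl). cbn [effects effect fst snd length] in X.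
    match type of X with _ = mkState _ ?m _ => set (M1 := m) in * end.
    assert (XE := exec_jump P _ M1 Rm _ _ CE).
    replace (M1 3) with 0 in XE by (unfold M1; upd_simpl; auto). cbn [Nat.eqb] in XE.
    destruct (IH M1) as (t & M' & T & E & E6 & F); try (unfold M1; upd_simpl; lia).
    exists (1 + (2 + (1 + t))), M'. split; [lia|]. split; [|split].
    + rewrite exec_add, XJ, exec_add, X, exec_add.
      match goal with |- exec _ _ (exec _ 1 ?s) = _ => change s with (mkState (S q + 2) M1 Rm) end.
      cbn [length] in XE. rewrite XE. exact E.
    + rewrite E6. unfold M1. upd_simpl. lia.
    + intros y Hy Hy'. rewrite F by assumption. unfold M1. now upd_simpl.
Qed.

Lemma copy_loop_correct P q Rm : code_at P q (copy_loop q) -> forall k M src dst,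
  M 0 = src -> M 1 = 1 -> M 2 = dst -> M 3 = 0 -> M 4 = k -> 5 <= src -> 5 <= dst ->
  src + k <= dst \/ dst + k <= src ->
  exists t M', t <= 8 * k + 1 /\ exec P t (mkState q M Rm) = mkState (q + 8) M' Rm /\
    M' 1 = 1 /\ M' 3 = 0 /\ (forall j, j < k -> M' (dst + j) = M (src + j)) /\
    forall y, 5 <= y -> y < dst \/ dst + k <= y -> M' y = M y.
Proof.
  intros C. unfold copy_loop in C. apply code_at_cons in C. destruct C as [CJ C].
  change [NLoad 3 0; NStore 2 3; NConst 3 0; NAdd 0 0 1; NAdd 2 2 1; NSub 4 4 1; NJz 3 q]
    with ([NLoad 3 0; NStore 2 3; NConst 3 0; NAdd 0 0 1; NAdd 2 2 1; NSub 4 4 1] ++ [NJz 3 q]) in C.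
  apply code_at_app in C. destruct C as [C CE]. apply code_at_cons in CE. destruct CE as [CE _].
  induction k as [|k IH]; intros M src dst H0 H1 H2 H3 H4 Hs Hd HD;
    assert (XJ := exec_jump P _ M Rm _ _ CJ); rewrite H4 in XJ; cbn [Nat.eqb] in XJ.
  - exists 1, M. repeat split; auto; lia.
  - assert (X := exec_straight P _ _ M Rm C eq_refl). cbn [effects effect fst snd length] in X.
    match type of X with _ = mkState _ ?m _ => set (M1 := m) in * end.
    assert (V : M1 0 = S src /\ M1 1 = 1 /\ M1 2 = S dst /\ M1 3 = 0 /\ M1 4 = k /\
      M1 dst = M src /\ forall y, 5 <= y -> y <> dst -> M1 y = M y).
    { unfold M1. rewrite H0. replace (upd M 3 (M src) 2) with dst by (now upd_simpl).
      repeat split; intros; upd_simpl; lia. }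
    destruct V as (V0 & V1 & V2 & V3 & V4 & VD & VY).
    assert (XE := exec_jump P _ M1 Rm _ _ CE). rewrite V3 in XE. cbn [Nat.eqb] in XE.
    destruct (IH M1 (S src) (S dst)) as (t & M' & T & E & E1 & E3 & F & G); auto; [lia..|].
    exists (1 + (6 + (1 + t))), M'. split; [lia|].
    split; [|split; [assumption|split; [assumption|split]]].
    + rewrite exec_add, XJ, exec_add, X, exec_add. cbn [length] in XE. rewrite XE. exact E.
    + intros j Hj. destruct j as [|j].
      * rewrite !Nat.add_0_r, G by lia. exact VD.
      * replace (dst + S j) with (S dst + j) by lia. rewrite F by lia.
        replace (src + S j) with (S src + j) by lia. apply VY; lia.
    + intros y Hy Hy'. rewrite G by lia. apply VY; lia.
Qed.

(** Used with a zero value to extend the instance by the dummy job [[0, 0)] of weight 0; padded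
    weights are nonnegative at every index. *)
Definition pad {A : Type} (n : nat) (z : A) (f : nat -> A) (i : nat) : A :=
  if i <? n then f i else z.

Lemma init_start n a b w i : i <= n -> mem (init_state n a b w) (2 * i + 1) = pad n 0 a i.
Proof.
  intros Hi. unfold init_state, pad. cbn [mem].
  rewrite (proj2 (Nat.eqb_neq (2 * i + 1) 0)) by lia.
  destruct (Nat.ltb_spec i n), (Nat.leb_spec (2 * i + 1) (2 * n)); try lia.
  replace (Nat.odd (2 * i + 1)) with true by (symmetry; apply Nat.odd_spec; now exists i).
  replace (2 * i + 1 - 1) with (i * 2) by lia. now rewrite Nat.div_mul by lia.
Qed.

Lemma init_end n a b w i : i <= n -> mem (init_state n a b w) (2 * i + 2) = pad n 0 b i.
Proof.
  intros Hi. unfold init_state, pad. cbn [mem].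
  rewrite (proj2 (Nat.eqb_neq (2 * i + 2) 0)) by lia.
  destruct (Nat.ltb_spec i n), (Nat.leb_spec (2 * i + 2) (2 * n)); try lia.
  replace (Nat.odd (2 * i + 2)) with false.
  - replace (2 * i + 2 - 2) with (i * 2) by lia. now rewrite Nat.div_mul by lia.
  - symmetry. rewrite <- Nat.negb_even. apply negb_false_iff, Nat.even_spec. exists (S i). lia.
Qed.

Lemma init_beyond n a b w i : 2 * n < i -> mem (init_state n a b w) i = 0.
Proof.
  intros Hi. unfold init_state. cbn [mem].
  now rewrite (proj2 (Nat.eqb_neq i 0)), (proj2 (Nat.leb_gt i (2 * n))) by lia.
Qed.

Definition empty_store : store := mkStore (fun _ => false) (fun _ _ => 0%R) (fun _ => 0%R).

Lemma save_code_correct M Rm n : 1 <= n -> M 0 = n ->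
  let M' := fst (effects save_code (M, Rm)) in
  snd (effects save_code (M, Rm)) = Rm /\
  M' 0 = 128 * n /\ M' 1 = 1 /\ M' 2 = 128 /\ M' 3 = 0 /\ M' 5 = 128 * n /\ M' 6 = 0 /\
  (forall j, j < 6 -> M' (128 * n + j) = M (S j)) /\
  (forall y, 7 <= y -> y < 128 * n \/ 128 * n + 6 <= y -> M' y = M y).
Proof.
  intros Hn H0. unfold save_code. rewrite !effects_app.
  destruct (effects_double 7 M Rm) as (E & F & G).
  destruct (effects (repeat (NAdd 0 0 0) 7) (M, Rm)) as [M1 R1]. cbn [fst snd] in *.
  change (2 ^ 7) with 128 in E. rewrite H0 in E. subst R1.
  cbn [effects effect]. rewrite E.
  set (M2 := upd (upd M1 (128 * n) (M1 1)) 1 1).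
  assert (V : M2 0 = 128 * n /\ M2 1 = 1 /\ M2 (128 * n) = M 1 /\
    forall y, 2 <= y -> y <> 128 * n -> M2 y = M y).
  { unfold M2. rewrite <- (F 1) by lia. repeat split; intros; upd_simpl; auto.
    apply F. lia. }
  clearbody M2. destruct V as (V0 & V1 & VB & VY).
  destruct (effects_save 5 M2 Rm V1 ltac:(lia)) as (E3 & F3 & G3 & K3).
  destruct (effects (save_registers 5) (M2, Rm)) as [M3 R3]. cbn [fst snd] in *. subst R3.
  rewrite V0 in *. cbn [effects effect fst snd].
  split; [reflexivity|]. repeat split; intros; upd_simpl; rewrite ?E3, ?G3 by lia; auto; try lia.
  - destruct j as [|j].
    + rewrite Nat.add_0_r, G3 by lia. assumption.
    + replace (128 * n + S j) with (128 * n + 1 + j) by lia. rewrite F3 by lia.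
      apply VY; lia.
  - apply VY; lia.
Qed.

Lemma setup_code_at P halt : code_at P 0 (setup_code halt) ->
  nth_error P 0 = Some (NJz 0 halt) /\ code_at P 1 save_code /\ code_at P 26 (divide_loop 26) /\
  code_at P 30 [NSub 4 6 1] /\ nth_error P 31 = Some (NJz 4 halt) /\
  code_at P 32 [NConst 2 6; NAdd 2 2 5; NConst 0 4; NAdd 4 6 6; NSub 4 4 0; NConst 0 7] /\
  code_at P 38 (copy_loop 38) /\
  code_at P 46 [NAdd 0 6 3; NAdd 2 0 1; NAdd 4 5 3; NAdd 5 4 1; NAdd 6 4 2; NAdd 6 6 2;
    NConst 7 16; NAdd 7 7 2].
Proof.
  intros C. unfold setup_code in C.
  apply code_at_app in C. destruct C as [C0 C]. apply code_at_cons in C0. destruct C0 as [C0 _].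
  apply code_at_app in C. destruct C as [C1 C]. change (0 + length [NJz 0 halt]) with 1 in *.
  apply code_at_app in C. change (1 + length save_code) with 26 in C. destruct C as [C2 C].
  apply code_at_app in C. change (26 + length (divide_loop 26)) with 30 in C. destruct C as [C3 C].
  cbn [length Nat.add] in C.
  apply code_at_app in C. destruct C as [C4 C]. apply code_at_cons in C4. destruct C4 as [C4 _].
  cbn [length Nat.add] in C.
  apply code_at_app in C. destruct C as [C5 C]. cbn [length Nat.add] in C.
  apply code_at_app in C. change (38 + length (copy_loop 38)) with 46 in C. destruct C as [C6 C7].
  auto 10.
Qed.

Lemma setup_start P halt n a b w : 1 <= n -> code_at P 0 (setup_code halt) ->
  exists t M, t <= 4 * n + 28 /\
    exec P t (init_state n a b w) = mkState 31 M (rmem (init_state n a b w)) /\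
    M 1 = 1 /\ M 3 = 0 /\ M 4 = n - 1 /\ M 5 = 128 * n /\ M 6 = n /\
    (forall j, j < 6 -> M (128 * n + j) = mem (init_state n a b w) (S j)) /\
    (forall y, 7 <= y -> y < 128 * n \/ 128 * n + 6 <= y -> M y = mem (init_state n a b w) y).
Proof.
  intros Hn C. apply setup_code_at in C. destruct C as (C0 & C1 & C2 & C3 & _).
  set (I := mem (init_state n a b w)). set (Rm := rmem (init_state n a b w)).
  change (init_state n a b w) with (mkState 0 I Rm).
  assert (I0 : I 0 = n) by reflexivity.
  assert (X0 := exec_jump P _ I Rm _ _ C0).
  rewrite I0, (proj2 (Nat.eqb_neq n 0)) in X0 by lia.
  assert (X1 := exec_straight P _ _ I Rm C1 eq_refl).
  destruct (save_code_correct I Rm n ltac:(lia) I0) as (S1 & A0 & A1 & A2 & A3 & A5 & A6 & AH & AY).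
  rewrite S1 in X1. set (M1 := fst (effects save_code (I, Rm))) in *. clearbody M1.
  change (length save_code) with 25 in X1. cbn [Nat.add] in X1.
  destruct (divide_loop_correct P 26 Rm C2 n M1 A0 A1 A2 A3) as (t2 & M2 & T2 & X2 & B6 & BY).
  cbn [Nat.add] in X2.
  assert (X3 := exec_straight P _ _ M2 Rm C3 eq_refl). cbn [length effects effect fst snd Nat.add] in X3.
  exists (1 + (25 + (t2 + 1))). eexists. split; [lia|]. split.
  - rewrite exec_add, X0, exec_add, X1, exec_add, X2. exact X3.
  - assert (E1 := BY 1 ltac:(lia) ltac:(lia)). assert (E3 := BY 3 ltac:(lia) ltac:(lia)).
    assert (E5 := BY 5 ltac:(lia) ltac:(lia)).
    repeat split; intros; upd_simpl; try lia; rewrite BY by lia; auto.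
Qed.

Lemma setup_correct P halt n a b w : 2 <= n -> code_at P 0 (setup_code halt) ->
  exists t M, t <= 20 * n + 50 /\
    exec P t (init_state n a b w) = mkState 54 M (rmem (init_state n a b w)) /\
    represents n (128 * n) (pad n 0 a) (pad n 0 b) (pad n 0%R w) 0 (fun _ => 0) (fun _ => 0)
      empty_store M (rmem (init_state n a b w)).
Proof.
  intros Hn C.
  destruct (setup_start P halt n a b w ltac:(lia) C)
    as (t3 & M3 & T3 & X3 & A1 & A3 & A4 & A5 & A6 & AH & AY).
  apply setup_code_at in C. destruct C as (_ & _ & _ & _ & C4 & C5 & C6 & C7).
  set (I := mem (init_state n a b w)) in *. set (Rm := rmem (init_state n a b w)) in *.
  assert (X4 := exec_jump P _ M3 Rm _ _ C4).
  rewrite A4, (proj2 (Nat.eqb_neq (n - 1) 0)) in X4 by lia.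
  assert (X5 := exec_straight P _ _ M3 Rm C5 eq_refl). cbn [length effects effect fst snd Nat.add] in X5.
  match type of X5 with _ = mkState _ ?m _ => set (M5 := m) in * end.
  assert (D : M5 0 = 7 /\ M5 1 = 1 /\ M5 2 = 128 * n + 6 /\ M5 3 = 0 /\ M5 4 = 2 * n - 4 /\
     M5 5 = 128 * n /\ M5 6 = n /\ forall y, 7 <= y -> M5 y = M3 y).
  { unfold M5. repeat split; intros; upd_simpl; lia. }
  clearbody M5. destruct D as (D0 & D1 & D2 & D3 & D4 & D5 & D6 & DY).
  destruct (copy_loop_correct P 38 Rm C6 (2 * n - 4) M5 7 (128 * n + 6)) as
    (t6 & M6 & T6 & X6 & E1 & E3 & EC & EY); [assumption..|lia|lia|lia|].
  cbn [Nat.add] in X6.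
  assert (X7 := exec_straight P _ _ M6 Rm C7 eq_refl). cbn [length effects effect fst snd Nat.add] in X7.
  match type of X7 with _ = mkState _ ?m _ => set (M7 := m) in * end.
  assert (E5 := EY 5 ltac:(lia) ltac:(lia)). assert (E6 := EY 6 ltac:(lia) ltac:(lia)).
  assert (F : M7 0 = n /\ M7 1 = 1 /\ M7 2 = n + 1 /\ M7 3 = 0 /\ M7 4 = 128 * n /\
     M7 5 = 128 * n + 1 /\ M7 6 = 128 * n + 2 * n + 2 /\ M7 7 = n + 17 /\
     forall y, 8 <= y -> M7 y = M6 y).
  { unfold M7. repeat split; intros; upd_simpl; lia. }
  clearbody M7. destruct F as (F0 & F1 & F2 & F3 & F4 & F5 & F6 & F7 & FY).
  (* The first six cells come from the saved registers and the rest from the copy loop; the range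
     includes the two zeros of the dummy. *)
  assert (HEAP : forall j, j < 2 * n + 2 -> M7 (128 * n + j) = I (S j)).
  { intros j Hj. rewrite FY by lia. destruct (Nat.lt_ge_cases j 6) as [H|H].
    - rewrite EY, DY by lia. now apply AH.
    - replace (128 * n + j) with (128 * n + 6 + (j - 6)) by lia. rewrite EC by lia.
      rewrite DY, AY by lia. f_equal. lia. }
  exists (t3 + (1 + (6 + (t6 + 8)))), M7.
  split; [lia|]. split.
  - rewrite exec_add, X3, exec_add, X4, exec_add, X5, exec_add, X6. exact X7.
  - split; try assumption; try (intros; lia).
    + intros i Hi. rewrite HEAP by lia. replace (S (2 * i)) with (2 * i + 1) by lia.
      now apply init_start.
    + intros i Hi. replace (128 * n + 1 + 2 * i) with (128 * n + (2 * i + 1)) by lia.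
      rewrite HEAP by lia. replace (S (2 * i + 1)) with (2 * i + 2) by lia. now apply init_end.
    + intros i Hi. rewrite FY, EY, DY, AY by lia. apply init_beyond. lia.
    + intros i Hi. unfold Rm, pad. cbn [init_state rmem]. reflexivity.
    + intros c Hc. unfold Rm. cbn [init_state rmem empty_store scalars].
      now rewrite (proj2 (Nat.ltb_ge (n + 1 + c) n)) by lia.
    + intros i j Hi Hj. unfold Rm. cbn [init_state rmem empty_store table].
      now rewrite (proj2 (Nat.ltb_ge (n + 17 + (i * (n + 1) + j)) n)) by lia.
Qed.

Lemma output_correct P q n a b w v counts s M Rm : 2 <= n -> code_at P q (output_code q) ->
  represents n (128 * n) a b w 0 v counts s M Rm ->
  exists t M', t <= 8 * n + 4 /\ exec P t (mkState q M Rm) = mkState (q + 11) M' Rm /\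
    forall j, j < n -> M' (2 * n + 1 + j) = Nat.b2n (members s j).
Proof.
  intros Hn C H. unfold output_code in C. apply code_at_app in C. destruct C as [C0 C].
  cbn [length] in C. assert (X0 := exec_straight P _ _ M Rm C0 eq_refl).
  cbn [length effects effect fst snd] in X0.
  match type of X0 with _ = mkState _ ?m _ => set (M1 := m) in * end.
  assert (RM := rep_member _ _ _ _ _ _ _ _ _ _ _ H). destruct H.
  assert (D : M1 0 = 128 * n + 2 * n + 2 /\ M1 1 = 1 /\ M1 2 = 2 * n + 1 /\ M1 3 = 0 /\ M1 4 = n /\
     forall y, 5 <= y -> M1 y = M y).
  { unfold M1. repeat split; intros; upd_simpl; lia. }
  clearbody M1. destruct D as (D0 & D1 & D2 & D3 & D4 & DY).
  destruct (copy_loop_correct P (q + 3) Rm C n M1 (128 * n + 2 * n + 2) (2 * n + 1)) as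
    (t & M' & T & X & _ & _ & EC & _); [assumption..|lia|lia|lia|].
  exists (3 + t), M'. split; [lia|]. split.
  - rewrite exec_add, X0, X. f_equal. lia.
  - intros j Hj. rewrite EC, DY by lia. apply RM. lia.
Qed.

(** * Tiny instances and the final assembly *)

Open Scope R_scope.

(** With a single job the adversary always forces 0: it deletes the job if selected, and bars it
    from being added if not. Hence any memory contents form a correct output for [n = 1]. *)
Lemma single_job_optimal (a b : nat -> nat) (w : nat -> R) (S : nat -> bool) :
  0 <= w 0%nat -> optimal_robust 1 a b w S.
Proof.
  intros Hw. split.
  { apply feasible_iff. intros. lia. }
  assert (V : forall T, robust_value 1 a b w T = 0).
  { intros T.
    rewrite (robust_value_ext 1 a b a b w (pad 1 0 w) T T)
      by (intros j Hj; unfold pad; now rewrite (proj2 (Nat.ltb_lt j 1) Hj)).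
    set (w' := pad 1 0 w).
    assert (FT : feasible 1 a b T) by (apply feasible_iff; intros; lia).
    assert (W : weight 1 w' T = deleted_weight 1 w' T 0)
      by (unfold weight, deleted_weight; cbn; destruct (T 0%nat); lra).
    assert (W0 : w' 1%nat = 0) by reflexivity.
    assert (W1 : 0 <= w' 0%nat) by exact Hw.
    apply Rle_antisym.
    - eapply Rle_trans; [apply (robust_value_le 1 a b w' T 0); lia|].
      destruct (recovery_attained 1 a b w' T 0 W0 FT ltac:(lia)) as (e & [->|He] & ->); [|lia].
      lra.
    - destruct (robust_value_attained 1 a b w' T) as (f & Hf & ->).
      eapply Rle_trans; [|apply (recovery_ge 1 a b w' T f 1 W0 FT Hf); now left].
      rewrite W, W0. assert (f = 0 \/ f = 1)%nat as [-> | ->] by lia; [lra|].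
      unfold deleted_weight. cbn. destruct (T 0%nat); lra. }
  intros T _. rewrite !V. lra.
Qed.

Lemma optimal_robust_ext n a b w a' b' w' S S' :
  (forall j, (j < n)%nat -> a j = a' j /\ b j = b' j /\ w j = w' j /\ S j = S' j) ->
  optimal_robust n a b w S -> optimal_robust n a' b' w' S'.
Proof.
  intros E [F O].
  assert (EF : forall T, feasibleb n a' b' T = feasibleb n a b T).
  { intros T. apply feasibleb_ext. intros j Hj. destruct (E j Hj) as (-> & -> & _). auto. }
  split.
  - unfold feasible in *. rewrite EF, <- F. apply feasibleb_ext.
    intros j Hj. destruct (E j Hj) as (_ & _ & _ & ->). auto.
  - intros T FT. unfold feasible in *. rewrite EF in FT. specialize (O T FT).
    rewrite <- (robust_value_ext n a b a' b' w w' S S') by assumption.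
    rewrite <- (robust_value_ext n a b a' b' w w' T T); [assumption|].
    intros j Hj. destruct (E j Hj) as (-> & -> & -> & _). auto.
Qed.

Lemma halted_at_end P M Rm : halted P (mkState (length P) M Rm).
Proof.
  unfold halted. cbn [pc]. destruct (nth_error P (length P)) eqn:E; [|trivial].
  assert (nth_error P (length P) <> None) as H by congruence. apply nth_error_Some in H. lia.
Qed.

(* There is a program of the real-RAM which, on every instance with n jobs,
   halts within c*(n+1)^k steps and outputs an optimal first-stage solution. *)
Theorem theorem6 :
  exists (P : program) (c k : nat),
    forall (n : nat) (a b : nat -> nat) (w : nat -> R),
      (forall j, (j < n)%nat -> (a j <= b j)%nat) ->
      (forall j, (j < n)%nat -> 0 <= w j) ->
      exists t : nat,
        (t <= c * (n + 1) ^ k)%nat /\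
        halted P (exec P t (init_state n a b w)) /\
        optimal_robust n a b w (output n (exec P t (init_state n a b w))).
Proof.
  destruct (time_polynomial algorithm) as (C & k & HT).
  (* The extra 100 absorbs at most [20 * n + 50] steps of setup and [8 * n + 4] of output; raising
     the exponent to [k + 1] guarantees a linear term. *)
  exists (full_program algorithm), (C + 100)%nat, (k + 1)%nat. intros n a b w _ Hw.
  assert (HL := full_program_length algorithm).
  assert (HC := code_at_whole (full_program algorithm)). unfold full_program in HC at 2.
  apply code_at_app in HC. destruct HC as [C1 HC].
  change (0 + length (setup_code (65 + code_size algorithm)))%nat with 54%nat in HC.
  apply code_at_app in HC. destruct HC as [C2 C3]. rewrite compile_length in C3.
  set (P := full_program algorithm) in *. clearbody P.
  assert (POW : (n + 1 <= (n + 1) ^ (k + 1))%nat).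
  { rewrite <- (Nat.pow_1_r (n + 1)) at 1. apply Nat.pow_le_mono_r; lia. }
  assert (n = 0 \/ n = 1 \/ 2 <= n)%nat as [->|[->|Hn]] by lia.
  - exists 1%nat. split; [lia|].
    apply setup_code_at in C1. destruct C1 as (C0 & _).
    assert (X : exec P 1 (init_state 0 a b w) =
      mkState (65 + code_size algorithm) (mem (init_state 0 a b w)) (rmem (init_state 0 a b w)))
      by exact (exec_jump P 0 _ _ _ _ C0).
    rewrite X, <- HL. split; [apply halted_at_end|]. split; [reflexivity|].
    intros T _. erewrite robust_value_ext; [apply Rle_refl|]. intros; lia.
  - destruct (setup_start P _ 1 a b w ltac:(lia) C1) as (t & M & T & X & _ & _ & A4 & _).
    apply setup_code_at in C1. destruct C1 as (_ & _ & _ & _ & C4 & _).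
    assert (XJ := exec_jump P _ M (rmem (init_state 1 a b w)) _ _ C4).
    rewrite A4 in XJ. cbn [Nat.sub Nat.eqb] in XJ.
    exists (t + 1)%nat. split; [lia|]. rewrite exec_add, X, XJ, <- HL.
    split; [apply halted_at_end|]. apply single_job_optimal, Hw. lia.
  - destruct (setup_correct P _ n a b w Hn C1) as (t1 & M1 & T1 & X1 & R1).
    set (a' := pad n 0%nat a) in *. set (b' := pad n 0%nat b) in *. set (w' := pad n 0 w) in *.
    assert (W0 : w' n = 0) by (unfold w', pad; now rewrite Nat.ltb_irrefl).
    assert (E0 : (b' n <= a' n)%nat) by (unfold a', b', pad; now rewrite !Nat.ltb_irrefl).
    assert (WP : forall j, 0 <= w' j).
    { intros j. unfold w', pad. destruct (Nat.ltb_spec j n); [auto|lra]. }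
    (* Well-formedness of [algorithm] is checked by computation, through [eq_refl]; its code starts
       at 54, after the setup. *)
    destruct (compile_correct n (128 * n) a' b' w' ltac:(lia) W0 P algorithm 54 0 _ _ _ M1 _
                C2 eq_refl ltac:(lia) R1) as (t2 & M2 & Rm2 & T2 & X2 & R2).
    destruct (output_correct P _ n _ _ _ _ _ _ _ _ Hn C3 R2) as (t3 & M3 & T3 & X3 & O3).
    exists (t1 + (t2 + t3))%nat. rewrite exec_add, X1, exec_add, X2, X3.
    split; [|split].
    + specialize (HT n). rewrite (Nat.add_1_r k) in *. cbn [Nat.pow] in *.
      assert (C * (n + 1) ^ k <= C * ((n + 1) * (n + 1) ^ k))%nat
        by (apply Nat.mul_le_mono_l; nia).
      lia.
    + replace (54 + code_size algorithm + 11)%nat with (length P) by lia. apply halted_at_end.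
    + eapply optimal_robust_ext;
        [|exact (algorithm_correct n a' b' w' E0 W0 WP (fun _ => 0%nat) empty_store)].
      intros j Hj. unfold a', b', w', pad. rewrite !(proj2 (Nat.ltb_lt j n) Hj).
      repeat split. unfold output. rewrite (proj2 (Nat.ltb_lt j n) Hj). cbn [mem andb].
      rewrite O3 by assumption. now destruct (members _ j).
Qed.
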